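(* Let $K$ be a number field with ring of integers $\mathcal O_K$, and let $R=\mathrm{Int}(\mathcal O_K)=\{f\in K[X]\mid f(\mathcal O_K)\subseteq\mathcal O_K\}$. Then the two-dimensional Prüfer domain $R$ has the stacked bases property if and only if: for every matrix $B\in\mathcal M_{2\times2}(R)$ such that $\mathrm{cont}(B)=R$, there exists $C\in\mathcal M_{2\times2}(R)$ such that $\mathrm{cont}(BC)=R$ and $\det(BC)=0$. Moreover, in this criterion one may restrict to the matrices $$B=\begin{pmatrix}a&c\\ b&d\end{pmatrix}$$ with $a\in\mathcal O_K$, $a\ne0$, $a\notin\mathcal O_K^\times$, $(a,c,d)=R$ and $\det(B)\notin\mathcal O_K$; that is, $R$ has the stacked bases property if and only if for every such $B$ there exists $C\in\mathcal M_{2\times2}(R)$ with $\mathrm{cont}(BC)=R$ and $\det(BC)=0$.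
   Context: The content $\mathrm{cont}(A)$ of a matrix $A$ with coefficients in a commutative ring $R$ is the ideal of $R$ generated by its coefficients. $(a,c,d)$ denotes the ideal of $R$ generated by $a,c,d$. $\mathcal O_K$ is regarded as the subring of constant polynomials in $R$. An integral domain $D$ has the stacked bases property if, for every free $D$-module $M$ of finite rank $m$ and every finitely generated submodule $N$ of $M$ of rank $n\le m$, there exist rank-one projective $D$-modules $P_1,\dots,P_m$ and nonzero ideals $\mathfrak I_1,\dots,\mathfrak I_n$ of $D$ such that $M=P_1\oplus\cdots\oplus P_m$ (internal direct sum of submodules), $N=\mathfrak I_1P_1\oplus\cdots\oplus\mathfrak I_nP_n$, and $\mathfrak I_{j+1}\subseteq\mathfrak I_j$ for $1\le j\le n-1$. *)

(* Defs.v *)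
From HB Require Import structures.
From mathcomp Require Import all_boot all_order all_algebra all_field.
From mathcomp Require Import boolp classical_sets.

Set Implicit Arguments.
Unset Strict Implicit.
Unset Printing Implicit Defensive.

Import GRing.Theory.

Local Open Scope classical_set_scope.
Local Open Scope ring_scope.

Section LinearSpan.
Variables (D : comNzRingType) (M : lmodType D).

Definition lin_indep (k : nat) (v : 'I_k -> M) : Prop :=
  forall c : 'I_k -> D, \sum_i c i *: v i = 0 -> forall i, c i = 0.

Definition span (S : set M) : set M :=
  [set x | exists k (c : 'I_k -> D) (s : 'I_k -> M),
     (forall i, S (s i)) /\ x = \sum_i c i *: s i].

Definition free_of_rank (m : nat) : Prop :=
  exists e : 'I_m -> M, lin_indep e /\ span (range e) = [set: M].

Definition fin_gen : Prop :=
  exists k (v : 'I_k -> M), span (range v) = [set: M].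

(* Over a domain D with fraction field F this is dim_F (F \otimes_D M) = n. *)
Definition has_rank (n : nat) : Prop :=
  (exists v : 'I_n -> M, lin_indep v) /\
  (forall k (v : 'I_k -> M), lin_indep v -> (k <= n)%N).

Definition projective : Prop :=
  forall (A B : lmodType D) (g : {linear A -> B}) (f : {linear M -> B}),
    (forall b, exists a, g a = b) ->
    exists h : {linear M -> A}, forall x, g (h x) = f x.

Definition is_internal_dsum (N : set M) (k : nat) (Q : 'I_k -> set M) : Prop :=
  N = [set x | exists y : 'I_k -> M,
         (forall i, Q i (y i)) /\ x = \sum_i y i] /\
  (forall y : 'I_k -> M,
     (forall i, Q i (y i)) -> \sum_i y i = 0 -> forall i, y i = 0).

End LinearSpan.

Section SubmoduleAsModule.
Variables (D : comNzRingType) (M : lmodType D) (P : submodClosed M).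

Definition submod : Type := {x : M | x \in P}.

HB.instance Definition _ := [isSub of submod for @sval M (fun x => x \in P)].
HB.instance Definition _ := [Choice of submod by <:].
HB.instance Definition _ := [SubChoice_isSubLmodule of submod by <:].

End SubmoduleAsModule.

(* Ideals of D, the improper one included, are the submodules of the regular
   module D^o; the library's [idealr] only covers proper ideals. *)
Definition ideal (D : comNzRingType) := submodClosed D^o.

Definition ideal_smul (D : comNzRingType) (M : lmodType D)
    (I : ideal D) (P : submodClosed M) : set M :=
  span [set x | exists a p, a \in I /\ p \in P /\ x = (a : D) *: p].

Definition stacked_bases (D : idomainType) : Prop :=
  forall (m n : nat) (le_nm : (n <= m)%N) (M : lmodType D)
         (N : submodClosed M),
    free_of_rank M m -> fin_gen (submod N) -> has_rank (submod N) n ->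
    exists (P : 'I_m -> submodClosed M) (I : 'I_n -> ideal D),
      (forall i, projective (submod (P i)) /\ has_rank (submod (P i)) 1) /\
      (forall j, exists2 a, a \in I j & a != 0) /\
      is_internal_dsum [set: M] (fun i => [set` P i]) /\
      is_internal_dsum [set` N]
        (fun j => ideal_smul (I j) (P (widen_ord le_nm j))) /\
      (forall j j' : 'I_n, j' = j.+1 :> nat -> {subset I j' <= I j}).

Definition ideal_gen (R : comNzRingType) (S : set R) : set R :=
  @span R R^o S.

Definition cont (R : comNzRingType) (m n : nat) (A : 'M[R]_(m, n)) : set R :=
  ideal_gen [set x | exists i j, x = A i j].

Definition mx22 (R : comNzRingType) (a c b d : R) : 'M[R]_2 :=
  \matrix_(i, j) if i == ord0 then (if j == ord0 then a else c)
                 else (if j == ord0 then b else d).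

Section IntegerValued.
Variable K : fieldExtType rat.

Definition OK : {pred K} :=
  fun x => `[< integralOver (intr : int -> K) x >].

Definition int_valued_pred : {pred {poly K}} :=
  fun f => `[< forall x, x \in OK -> f.[x] \in OK >].

Lemma OKP x : reflect (integralOver (intr : int -> K) x) (x \in OK).
Proof. exact: asboolP. Qed.

Lemma int_valued_subring : subring_closed int_valued_pred.
Proof.
split=> [|f g /asboolP If /asboolP Ig|f g /asboolP If /asboolP Ig];
  apply/asboolP => x Ox; apply/OKP.
- by rewrite hornerC; exact: integral1.
- by rewrite hornerD hornerN; apply: integral_sub; apply/OKP; auto.
- by rewrite hornerM; apply: integral_mul; apply/OKP; auto.
Qed.

Definition IntOK : Type := {f : {poly K} | f \in int_valued_pred}.

HB.instance Definition _ :=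
  [isSub of IntOK for @sval {poly K} (fun f => f \in int_valued_pred)].
HB.instance Definition _ := [Choice of IntOK by <:].
HB.instance Definition _ :=
  GRing.SubChoice_isSubComNzRing.Build {poly K} int_valued_pred IntOK
    int_valued_subring.

Definition IntOK_unit : {pred IntOK} :=
  fun f => `[< exists g : IntOK, g * f = 1 >].

Definition IntOK_inv (f : IntOK) : IntOK :=
  if pselect (exists g : IntOK, g * f = 1) is left h then projT1 (cid h) else f.

Lemma IntOK_mulVf : {in IntOK_unit, left_inverse 1 IntOK_inv *%R}.
Proof.
move=> f /asboolP Uf; rewrite /IntOK_inv; case: pselect => // h.
by case: (cid h).
Qed.

Lemma IntOK_unitP (f g : IntOK) : g * f = 1 -> f \in IntOK_unit.
Proof. by move=> gf1; apply/asboolP; exists g. Qed.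

Lemma IntOK_inv_out : {in [predC IntOK_unit], IntOK_inv =1 id}.
Proof.
move=> f /negP nUf; rewrite /IntOK_inv; case: pselect => // h.
by case: nUf; apply/asboolP.
Qed.

HB.instance Definition _ :=
  GRing.ComNzRing_hasMulInverse.Build IntOK
    IntOK_mulVf IntOK_unitP IntOK_inv_out.

Lemma IntOK_integral : GRing.integral_domain_axiom IntOK.
Proof.
move=> f g fg0; have /eqP : val f * val g = 0 by rewrite -rmorphM fg0 rmorph0.
by rewrite mulf_eq0 -!(inj_eq val_inj) rmorph0.
Qed.

HB.instance Definition _ :=
  GRing.ComUnitRing_isIntegral.Build IntOK IntOK_integral.

Definition constOK : set IntOK :=
  [set f | exists2 x : K, x \in OK & val f = x%:P].

Definition unitsOK : set IntOK :=
  [set f | constOK f /\ exists2 g, constOK g & f * g = 1].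

End IntegerValued.

(* Main.v *)
From HB Require Import structures.
Require Import Defs.
From mathcomp Require Import all_boot all_order all_algebra all_field.
From mathcomp Require Import boolp classical_sets.
From mathcomp Require Import ring.

Set Implicit Arguments.
Unset Strict Implicit.
Unset Printing Implicit Defensive.

Import GRing.Theory.

Local Open Scope classical_set_scope.
Local Open Scope ring_scope.

(** Write [O] for the ring of integers of [K] and [R] for the ring of
    integer-valued polynomials. Three implications close the circle: the
    stacked bases property gives the criterion for all 2x2 matrices of unit
    content, this contains the restricted criterion, and the restricted
    criterion gives stacked bases.

    If [M = D^2] and [N] is the column space of a matrix [B] of unit content,
    then the largest ideal [I_0] of a stacked decomposition contains the
    entries of [B], so that [I_0 = D] and [P_0] lies in [N]. The projection of
    [M] onto [P_0] is therefore of the form [B * C]; it is idempotent with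
    determinant 0 and trace 1 ([stacked_bases_criterion]).

    Conversely, two facts about a domain of characteristic zero give stacked
    bases ([stacked_bases_of_splitting]): it is arithmetical, i.e. a Pruefer
    domain, and the column space of a matrix of unit content contains a direct
    summand of rank one of the free module ([rank1_splitting]). Given [N] in
    [M], one divides [N] by its content [I], finds a summand [P] of rank one
    in [I^-1 N], splits [M = P + M'] and [N = I P + (N inter M')], and goes on
    with [M']. Summands are images of idempotent matrices, and the trace of
    such a matrix is its rank, on which one inducts ([stacked_idempotents]).

    [R] is arithmetical ([IntOK_arithmetical]): after division by the greatest
    common divisor in [K[X]], two elements of [R] generate an ideal with a
    positive integer [n] in it, so only prime ideals [M] of [R] that contain a
    prime number [p] matter. Put [P] for the intersection of [M] with [O]. As
    [O / p] is finite, the localization of [O] at [P] is a discrete valuation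
    ring, and a uniformizer [pi] of it divides every [f] in [M] locally at [M]
    ([uniformizer_dvd]), since the product of [f] with the [f - r], for [r]
    among finitely many representatives outside [P], takes its values in [P].
    So [pi] generates the maximal ideal of the localization of [R] at [M];
    elements there are units times powers of [pi] up to any given order, and
    this is enough to compare two elements that generate [n].

    Let [B] be any matrix over [R] of unit content and [f] its bilinear form
    [x * B * y]. Over the principal ideal domain [K[X]] the form takes the
    value 1, so over [R] it takes a positive integer as value, and hence an
    even one [a = f x v] ([constant_value]). Modulo [a] the ring [R] has
    dimension zero, because [O / a] is finite, so [f y w = 1] modulo [a] for
    some [y], [w] ([unimodular_value]). Unless [B] has rank one already, a
    change of [y] and [w] by multiples of [a] makes the 2x2 matrix of values
    of [f] on [x], [y] and [v], [w] satisfy all conditions of the restricted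
    criterion, including that its determinant is not constant. Since this
    determinant is nonzero, the matrix [C] of the criterion has determinant 0,
    and [C] yields a summand of rank one in the column space of [B]
    ([splitting_of_criterion]). *)

(** * Matrices of rank at most one *)

Section RankOne.
Variable D : comNzRingType.

Definition rank1_mx m s (A : 'M[D]_(m, s)) :=
  forall i k j l, A i j * A k l = A i l * A k j.

Lemma rank1_mulmxr m s t (A : 'M[D]_(m, s)) (B : 'M_(s, t)) :
  rank1_mx A -> rank1_mx (A *m B).
Proof.
move=> rA i k j l; rewrite !mxE !mulr_suml.
under eq_bigr do rewrite mulr_sumr.
under [RHS]eq_bigr do rewrite mulr_sumr.
rewrite exchange_big /=; apply: eq_bigr => a _; apply: eq_bigr => b _.
by rewrite mulrACA (rA i k b a) -mulrACA; ring.
Qed.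

Lemma rank1_mulmxl m s t (A : 'M[D]_(m, s)) (B : 'M_(s, t)) :
  rank1_mx B -> rank1_mx (A *m B).
Proof.
move=> rB i k j l; rewrite !mxE !mulr_suml.
under eq_bigr do rewrite mulr_sumr.
under [RHS]eq_bigr do rewrite mulr_sumr.
apply: eq_bigr => a _; apply: eq_bigr => b _.
by rewrite mulrACA (rB a b j l); ring.
Qed.

Lemma rank1_mulmx3 m s (A : 'M[D]_(m, s)) (Y : 'M_(s, m)) :
  rank1_mx A -> A *m Y *m A = \tr (A *m Y) *: A.
Proof.
move=> rA; apply/matrixP=> i l; rewrite mxE [RHS]mxE /mxtrace mulr_suml.
apply: eq_bigr => k _; rewrite !mxE !mulr_suml; apply: eq_bigr => j _.
by rewrite mulrAC (rA i k j l); ring.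
Qed.

Lemma rank1_mulmx2 m (E : 'M[D]_m) : rank1_mx E -> E *m E = \tr E *: E.
Proof. by move=> rE; rewrite -{1}[E]mulmx1 (rank1_mulmx3 _ rE) mulmx1. Qed.

End RankOne.

(** * Localization matrices of finitely generated ideals *)

Section Localization.
Variable D : comNzRingType.

(** In a domain this first-order condition says that every ideal [(f, g)] is
    locally principal, hence invertible when nonzero: one of [f], [g] divides
    the other after inverting [b], respectively [1 - b]. *)
Definition arithmetical :=
  forall f g : D, exists b c e : D, b * g = c * f /\ (1 - b) * f = e * g.

(** To add a generator [c], compare it with each [b k]: on the part [s k] of
    the piece [T k k] where [c] divides [b k], it divides all [b l], and these
    parts add up to the new diagonal entry; on the rest [b k] stays a
    generator. *)
Lemma localization_nat (arithD : arithmetical) r (b : nat -> D) :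
  exists T : nat -> nat -> D, \sum_(k < r.+1) T k k = 1 /\
    forall k l j, (k <= r)%N -> (l <= r)%N -> (j <= r)%N ->
      T k l * b j = T k j * b l.
Proof.
elim: r => [|r [T [trT Tb]]].
  exists (fun _ _ => 1); split; first by rewrite big_ord1.
  by move=> k l j _; rewrite !leqn0 => /eqP-> /eqP->.
pose c := b r.+1.
have /choice[s /choice[u /choice[w suw]]] k : exists s u w,
  s * b k = u * c /\ (1 - s) * c = w * b k by apply: arithD.
have sb k : s k * b k = u k * c by case: (suw k).
have sc k : (1 - s k) * c = w k * b k by case: (suw k).
exists (fun k l => if (k <= r)%N then
    if (l <= r)%N then (1 - s k) * T k l else T k k * w k
  else if (l <= r)%N then \sum_(i < r.+1) u i * T i l
  else \sum_(i < r.+1) s i * T i i); split.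
  rewrite big_ord_recr /= ltnn -[RHS]trT.
  under eq_bigr => i _ do rewrite -ltnS ltn_ord.
  by rewrite -big_split; apply: eq_bigr => i _ /=; ring.
have Tc i j : (i <= r)%N -> (j <= r)%N ->
  (1 - s i) * T i j * c = T i i * w i * b j.
  move=> ir jr; transitivity (w i * (T i j * b i)); last by rewrite Tb //; ring.
  by rewrite mulrAC sc; ring.
have Tu j : (j <= r)%N ->
  (\sum_(i < r.+1) u i * T i j) * c = (\sum_(i < r.+1) s i * T i i) * b j.
  move=> jr; rewrite !mulr_suml; apply: eq_bigr => i _.
  have ir : (i <= r)%N by rewrite -ltnS.
  transitivity (s i * (T i j * b i)); last by rewrite Tb //; ring.
  by rewrite mulrAC -sb; ring.
have over i : (i <= r.+1)%N -> (i <= r)%N = false -> b i = c.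
  by move=> ir /negbT; rewrite -ltnNge => ri; have -> : i = r.+1
    by apply/eqP; rewrite eqn_leq ir ri.
move=> k l j kr lr jr.
case: (leqP k r) => [kr'|rk]; case Hl: (l <= r)%N; case Hj: (j <= r)%N.
- by rewrite -!mulrA Tb.
- by rewrite (over j) // Tc.
- by rewrite (over l) // -Tc.
- by rewrite (over l) ?(over j).
- rewrite !mulr_suml; apply: eq_bigr => i _; rewrite -!mulrA Tb //.
  by rewrite -ltnS.
- by rewrite (over j) // Tu.
- by rewrite (over l) // -Tu.
- by rewrite (over l) ?(over j).
Qed.

(** The principal localization matrix of a finitely generated ideal: the row
    [T k] divided by its diagonal entry expresses all generators as multiples
    of [b k] after inverting [T k k], and these diagonal entries add up to 1.
    If some [b k] is nonzero then [T k l = y k * b l] for elements [y k] of the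
    inverse fractional ideal. *)
Lemma localization_matrix (arithD : arithmetical) (J : finType) (j0 : J)
    (b : J -> D) :
  exists T : J -> J -> D, \sum_k T k k = 1 /\
    forall k l j, T k l * b j = T k j * b l.
Proof.
have [r cJ] : {r | #|J| = r.+1}.
  by exists #|J|.-1; rewrite prednK //; apply/card_gt0P; exists j0.
pose e (i : nat) : J := nth j0 (enum J) i.
have eK (x : J) : e (enum_rank x) = x by rewrite /e nth_enum_rank.
have [T [trT Tb]] := localization_nat arithD r (fun i => b (e i)).
exists (fun k l => T (enum_rank k) (enum_rank l)); split.
  rewrite -trT -cJ [RHS](reindex (@enum_rank J)) //.
  exact: onW_bij (enum_rank_bij J).
move=> k l j.
have lt (x : J) : (enum_rank x <= r)%N by rewrite -ltnS -cJ; apply: ltn_ord.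
by have := Tb (enum_rank k) (enum_rank l) (enum_rank j) (lt _) (lt _) (lt _);
  rewrite !eK.
Qed.

End Localization.

(** * Contents of matrices *)

Section EntryIdeal.
Variable D : comNzRingType.

(** Membership in the content of [A]: a linear combination of the entries of
    [A] is the trace of the product of [A] with the matrix of coefficients. *)
Definition in_cont m s (A : 'M[D]_(m, s)) (x : D) :=
  exists Y : 'M_(s, m), x = \tr (A *m Y).

Lemma in_cont_entry m s (A : 'M[D]_(m, s)) i j : in_cont A (A i j).
Proof.
exists (delta_mx j i); rewrite /mxtrace (bigD1 i) //= big1 => [|k ki].
  rewrite mxE (bigD1 j) //= big1 => [|l lj]; rewrite mxE ?eqxx ?mulr1 ?addr0 //.
  by rewrite (negPf lj) mulr0.
rewrite mxE big1 // => l _; rewrite mxE (negPf ki) andbF mulr0 //.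
Qed.

Lemma in_contD m s (A : 'M[D]_(m, s)) x y :
  in_cont A x -> in_cont A y -> in_cont A (x + y).
Proof.
by move=> [Y ->] [Z ->]; exists (Y + Z); rewrite mulmxDr mxtraceD.
Qed.

Lemma in_contM m s (A : 'M[D]_(m, s)) a x : in_cont A x -> in_cont A (a * x).
Proof. by move=> [Y ->]; exists (a *: Y); rewrite -scalemxAr mxtraceZ. Qed.

Lemma in_cont0 m s (A : 'M[D]_(m, s)) : in_cont A 0.
Proof. by exists 0; rewrite mulmx0 mxtrace0. Qed.

Lemma in_cont_sum m s (A : 'M[D]_(m, s)) (J : Type) (r : seq J) (P : pred J)
    (F : J -> D) :
  (forall i, P i -> in_cont A (F i)) -> in_cont A (\sum_(i <- r | P i) F i).
Proof.
by move=> AF; apply: big_ind => //; [apply: in_cont0 | apply: in_contD].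
Qed.

Lemma in_cont_sub m s m' s' (A : 'M[D]_(m, s)) (B : 'M_(m', s')) x :
  (forall i j, in_cont B (A i j)) -> in_cont A x -> in_cont B x.
Proof.
move=> AB [Y ->]; apply: in_cont_sum => i _; rewrite mxE.
by apply: in_cont_sum => j _; rewrite mulrC; apply: in_contM.
Qed.

Lemma in_cont_mulmx m s t u (A : 'M[D]_(m, s)) (B : 'M_(t, m)) (C : 'M_(s, u))
    i j : in_cont A ((B *m A *m C) i j).
Proof.
rewrite mxE; apply: in_cont_sum => k _; rewrite mulrC mxE; apply: in_contM.
by apply: in_cont_sum => l _; apply: in_contM; apply: in_cont_entry.
Qed.

Lemma in_cont_mulmxl m s t (A : 'M[D]_(m, s)) (B : 'M_(t, m)) i j :
  in_cont A ((B *m A) i j).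
Proof. by rewrite -[B *m A]mulmx1; apply: in_cont_mulmx. Qed.

Lemma in_cont_zero m s x : in_cont (0 : 'M[D]_(m, s)) x -> x = 0.
Proof. by move=> [Y ->]; rewrite mul0mx mxtrace0. Qed.

End EntryIdeal.

Lemma scalemx_inj (D : idomainType) (a : D) m n (A B : 'M_(m, n)) :
  a != 0 -> a *: A = a *: B -> A = B.
Proof.
move=> a0 /matrixP eAB; apply/matrixP=> i j; apply: (mulfI a0).
by have := eAB i j; rewrite !mxE.
Qed.

(** * Splitting off summands of rank one *)

Section Splitting.
Variable D : idomainType.

(** Each matrix of unit content has in its column space the image of an
    idempotent matrix of rank one, i.e. a projective direct summand of rank
    one of the ambient free module. *)
Definition rank1_splitting :=
  forall m s (B : 'M[D]_(m, s)) (Y : 'M_(s, m)), \tr (B *m Y) = 1 ->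
  exists2 Z : 'M_(s, m), \tr (B *m Z) = 1 & rank1_mx (B *m Z).

Hypothesis arithD : arithmetical D.
Hypothesis splitD : rank1_splitting.

(** When the content [I] of [B] is not the unit ideal, the matrix [Bp] of
    generators of [I^-1 N], for [N] the column space of [B], has unit content:
    it is the juxtaposition of the multiples [y *: B] with [y] in a family of
    generators of [I^-1], with coefficients read off a localization matrix. *)
Lemma split_off m s (F : 'M[D]_m) (B : 'M_(m, s)) :
  F *m F = F -> F *m B = B -> B != 0 ->
  exists E : 'M_m, [/\ E *m F = E, F *m E = E, rank1_mx E, \tr E = 1 &
    forall a, in_cont B a -> exists Y, a *: E = B *m Y].
Proof.
move=> FF FB B0.
have /existsP[i0 /existsP[j0 b0]] : [exists i, [exists j, B i j != 0]].
  apply: contraNT B0 => /existsPn B0; apply/eqP/matrixP=> i j.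
  by have /existsPn/(_ j)/negPn/eqP-> := B0 i; rewrite mxE.
pose J := ('I_m * 'I_s)%type; pose b (k : J) := B k.1 k.2.
have [T [trT Tb]] := localization_matrix arithD (i0, j0) b.
pose X := (J * 'I_s)%type.
pose Bp : 'M[D]_(m, #|{: X}|) :=
  \matrix_(i, x) T (enum_val x).1 (i, (enum_val x).2).
pose W (l : J) : 'M[D]_(s, #|{: X}|) :=
  \matrix_(j, x) if j == (enum_val x).2 then T (enum_val x).1 l else 0.
have BpW l : b l *: Bp = B *m W l.
  apply/matrixP=> i x; rewrite !mxE mulrC.
  rewrite (bigD1 (enum_val x).2) //= big1 => [|j /negPf nj]; rewrite !mxE.
    by rewrite eqxx addr0 Tb mulrC.
  by rewrite nj mulr0.
have FBp : F *m Bp = Bp.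
  apply: (scalemx_inj b0); rewrite scalemxAr -[B i0 j0]/(b (i0, j0)) BpW.
  by rewrite mulmxA FB.
pose Yp : 'M[D]_(#|{: X}|, m) :=
  \matrix_(x, i) if (enum_val x).1 == (i, (enum_val x).2) then 1 else 0.
have trBp : \tr (Bp *m Yp) = 1.
  rewrite -trT /mxtrace.
  transitivity (\sum_(i < m) \sum_(x : X)
      if x.1 == (i, x.2) then T x.1 (i, x.2) else 0).
    apply: eq_bigr => i _; rewrite mxE (reindex (@enum_rank X)) /=; last first.
      exact: onW_bij (enum_rank_bij X).
    by apply: eq_bigr => x _; rewrite !mxE enum_rankK; case: ifP;
      rewrite ?mulr1 ?mulr0.
  rewrite [RHS](eq_bigr (fun p : J => T (p.1, p.2) (p.1, p.2))); last by case.
  rewrite -(pair_bigA _ (fun i j => T (i, j) (i, j))) /=.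
  apply: eq_bigr => i _.
  rewrite -(pair_bigA _
    (fun k j => if k == (i, j) then T k (i, j) else 0)) exchange_big /=.
  by apply: eq_bigr => j _; rewrite -big_mkcond big_pred1_eq.
have [Z trZ rZ] := splitD trBp.
pose E := Bp *m Z; have FE : F *m E = E by rewrite mulmxA FBp.
exists (E *m F); split.
- by rewrite -mulmxA FF.
- by rewrite mulmxA FE.
- exact: rank1_mulmxr.
- by rewrite mxtrace_mulC FE.
move=> a [Y ->].
exists (\sum_(k : J) Y k.2 k.1 *: (W k *m Z *m F)).
rewrite mulmx_sumr /mxtrace.
under eq_bigr do rewrite mxE.
rewrite pair_bigA scaler_suml /=; apply: eq_bigr => k _.
by rewrite -scalemxAr !mulmxA -BpW mulrC -scalerA !scalemxAl.
Qed.

End Splitting.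

Lemma idem_trace_rank (L : fieldType) m (F : 'M[L]_m) :
  F *m F = F -> \tr F = (\rank F)%:R.
Proof.
move=> FF; have CW : col_base F *m row_base F = F by exact: mulmx_base.
suff WC : row_base F *m col_base F = 1%:M.
  by rewrite -{1}CW mxtrace_mulC WC mxtrace1.
apply: (row_full_inj (col_base_full F)); rewrite mulmx1.
apply: (row_free_inj (row_base_free F)) => /=.
by rewrite mulmxA CW -mulmxA CW FF.
Qed.

(** Over the fraction field the trace of an idempotent is its rank, which is
    detected in characteristic zero. *)
Lemma idem_trace0 (D : idomainType) (charD : forall n, n.+1%:R != 0 :> D) m
    (F : 'M[D]_m) : F *m F = F -> \tr F = 0 -> F = 0.
Proof.
move=> FF trF; pose f := @tofrac D.
have FF' : map_mx f F *m map_mx f F = map_mx f F by rewrite -map_mxM FF.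
have := idem_trace_rank FF'; rewrite trace_map_mx trF rmorph0.
case rk: (\rank _) => [|r].
  have /matrixP F0 : map_mx f F = 0 by apply/eqP; rewrite -mxrank_eq0 rk.
  move=> _; apply/matrixP=> i j; apply/eqP; rewrite mxE -tofrac_eq0.
  by have := F0 i j; rewrite !mxE /f => /eqP.
move/eqP; rewrite eq_sym -(rmorph_nat f) tofrac_eq0.
by rewrite (negPf (charD r)).
Qed.

Section Decomposition.
Variable D : idomainType.
Hypothesis arithD : arithmetical D.
Hypothesis splitD : rank1_splitting D.
Hypothesis charD : forall n, n.+1%:R != 0 :> D.

(** The image of [F] is decomposed into the images of the [E i], and the column
    space of [B] into the images of the [E i] multiplied by the content ideals
    of the [G i]; for a projection [E] of rank one, the elements of [I * im E]
    are those of [im E] with entries in [I]. The chain of ideals has length [r]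
    whatever the rank of [B] is: it ends in zero ideals. *)
Lemma stacked_idempotents r : forall m s (F : 'M[D]_m) (B : 'M_(m, s)),
  F *m F = F -> F *m B = B -> \tr F = r%:R ->
  exists (E : nat -> 'M[D]_m) (G : nat -> 'M[D]_(m, s)),
    [/\ forall i j, (i < r)%N -> (j < r)%N ->
          E i *m E j = if i == j then E i else 0,
        \sum_(i < r) E i = F,
        forall i, (i < r)%N -> rank1_mx (E i) /\ \tr (E i) = 1,
        forall i, (i.+1 < r)%N -> forall x, in_cont (G i.+1) x -> in_cont (G i) x
      & ((0 < r)%N -> forall x, in_cont (G 0) x -> in_cont B x) /\
        forall x : 'cV_m, (exists y, x = B *m y) <->
          (F *m x = x /\
           forall j i, (j < r)%N -> in_cont (G j) ((E j *m x) i 0))].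
Proof.
elim: r => [|r IHr] m s F B FF FB trF.
  have F0 : F = 0 by apply: idem_trace0.
  exists (fun _ => 0), (fun _ => 0); split=> //; first by rewrite big_ord0.
  split=> // x; split=> [[y ->]|[<- _]]; first by split; rewrite // mulmxA FB.
  by exists 0; rewrite F0 mul0mx mulmx0.
have Fn0 : F != 0.
  by apply: contra_eq_neq trF => ->; rewrite mxtrace0 eq_sym.
have [E [EF FE rE trE EB]] : exists E : 'M_m,
    [/\ E *m F = E, F *m E = E, rank1_mx E, \tr E = 1 &
    forall a, in_cont B a -> exists Y, a *: E = B *m Y].
  (* If [B] is zero, a summand of the image of [F] is split off instead. *)
  have [B0|B0] := eqVneq B 0; last exact: split_off.
  have [E [EF FE rE trE _]] := split_off arithD splitD FF FF Fn0.
  exists E; split=> // a; rewrite B0 => /in_cont_zero->.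
  by exists 0; rewrite scale0r mulmx0.
have EE : E *m E = E by rewrite rank1_mulmx2 // trE scale1r.
pose F' := F - E; pose B' := F' *m B.
have FF' : F' *m F' = F'.
  by rewrite mulmxBl !mulmxBr FF FE EF EE subrr subr0.
have F'E : F' *m E = 0 by rewrite mulmxBl FE EE subrr.
have EF' : E *m F' = 0 by rewrite mulmxBr EF EE subrr.
have [||E' [G' [EE' sE' rE' GG' [G0' NB']]]] := IHr m s F' B' FF'.
- by rewrite mulmxA FF'.
- by rewrite raddfB /= trF trE -natr1 addrK.
have E'F' i : (i < r)%N -> E' i *m F' = E' i.
  move=> ir; rewrite -sE' mulmx_sumr (bigD1 (Ordinal ir)) //= EE' // eqxx.
  rewrite big1 ?addr0 // => j; rewrite -val_eqE eq_sym /= => ji.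
  by rewrite EE' // (negPf ji).
have F'E' i : (i < r)%N -> F' *m E' i = E' i.
  move=> ir; rewrite -sE' mulmx_suml (bigD1 (Ordinal ir)) //= EE' // eqxx.
  rewrite big1 ?addr0 // => j; rewrite -val_eqE /= => ji.
  by rewrite EE' // (negPf ji).
have E'E i : (i < r)%N -> E' i *m E = 0.
  by move=> ir; rewrite -E'F' // -mulmxA F'E mulmx0.
have EE'0 i : (i < r)%N -> E *m E' i = 0.
  by move=> ir; rewrite -F'E' // mulmxA EF' mul0mx.
exists (fun i => if i is i'.+1 then E' i' else E).
exists (fun i => if i is i'.+1 then G' i' else B); split.
- by case=> [|i] [|j] //= ir jr; rewrite ?EE'0 ?E'E ?EE'.
- by rewrite big_ord_recl /= sE' addrCA subrr addr0.
- by case=> [|i] //; apply: rE'.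
- case=> [|i] //= ir x; last exact: GG'.
  by move/G0' => /(_ ir); apply: in_cont_sub; apply: in_cont_mulmxl.
split=> // x; split=> [[y ->]|[Fx Gx]].
  split; first by rewrite mulmxA FB.
  case=> [|j] i jr; first by rewrite mulmxA; apply: in_cont_mulmx.
  have [_ /(_ j i jr)] : F' *m (B' *m y) = B' *m y /\ forall j i, (j < r)%N ->
    in_cont (G' j) ((E' j *m (B' *m y)) i 0) by apply/NB'; exists y.
  by rewrite !mulmxA E'F'.
have /NB'[y xy] : F' *m (F' *m x) = F' *m x /\
    forall j i, (j < r)%N -> in_cont (G' j) ((E' j *m (F' *m x)) i 0).
  split; first by rewrite mulmxA FF'.
  by move=> j i jr; rewrite mulmxA E'F' //; apply: (Gx j.+1).
(* The error [z] has entries in the content of [B] and lies in the image of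
   [E], and such elements belong to the column space of [B]. *)
pose z := E *m (x - B *m y).
have Bz i : in_cont B (z i 0).
  rewrite /z mulmxBr mxE; apply: in_contD; first exact: (Gx 0).
  by rewrite mxE -mulN1r; apply: in_contM; rewrite mulmxA; apply: in_cont_mulmx.
have /choice[Y zY] i : exists Y, z i 0 *: E = B *m Y by apply: EB.
exists (y + \sum_i col i (Y i)).
have zz : E *m z = z by rewrite mulmxA EE.
have -> : x = B *m y + z.
  have : x - E *m x = B *m y - E *m (B *m y).
    by have := xy; rewrite /B' /F' !mulmxBl Fx FB mulmxA.
  by move/(canRL (subrK _))->; rewrite /z mulmxBr addrAC addrA.
rewrite mulmxDr -{1}zz; congr (_ + _).
apply/matrixP=> k l; rewrite ord1 mulmx_sumr summxE mxE.
by apply: eq_bigr => i _; rewrite colE mulmxA -zY -colE !mxE mulrC.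
Qed.

End Decomposition.

(** * From matrices to modules *)

(** Elimination without division: a pivot clears its row after the other
    columns have been multiplied by it. *)
Lemma kernel_wide (D : idomainType) p n (A : 'M[D]_(p, n)) :
  (p < n)%N -> exists2 c : 'cV_n, c != 0 & A *m c = 0.
Proof.
elim: p n A => [|p IHp] [|n] A // pn.
  exists (const_mx 1); last by rewrite (flatmx0 A) mul0mx.
  by apply/eqP=> /matrixP/(_ 0 0)/eqP; rewrite !mxE oner_eq0.
have [/existsP[k A0k]|/existsPn A0] := boolP [exists k, A 0 k != 0].
  pose B : 'M_(p, n) := \matrix_(i, j)
    (A 0 k * A (lift 0 i) (lift k j) - A (lift 0 i) k * A 0 (lift k j)).
  have [c c0 /matrixP Bc] := IHp n B pn.
  pose d : 'cV_n.+1 := \col_j (if unlift k j is Some j' then A 0 k * c j' 0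
                    else - \sum_j' A 0 (lift k j') * c j' 0).
  have dk : d k 0 = - \sum_j A 0 (lift k j) * c j 0.
    by rewrite mxE unlift_none.
  have dl j : d (lift k j) 0 = A 0 k * c j 0 by rewrite mxE liftK.
  exists d.
    apply: contra_neq c0 => d0; apply/matrixP=> j i; rewrite ord1 mxE.
    by apply: (mulfI A0k); rewrite -dl d0 mxE mulr0.
  apply/matrixP=> i j; rewrite ord1 mxE (bigD1_ord k) //= dk mxE.
  under eq_bigr do rewrite dl.
  rewrite mulrN mulr_sumr addrC; apply/eqP; rewrite subr_eq0; apply/eqP.
  case: (unliftP 0 i) => [i' ->|->]; last by apply: eq_bigr => l _; ring.
  apply/eqP; rewrite -subr_eq0 -sumrB; apply/eqP.
  have := Bc i' 0; rewrite mxE [RHS]mxE => Bc0; rewrite -[RHS]Bc0.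
  apply: eq_bigr => l _.
  by rewrite mxE; ring.
have [c c0 Ac] := IHp n.+1 (row' 0 A) (ltnW pn).
exists c => //; apply/matrixP=> i j; rewrite [RHS]mxE.
case: (unliftP 0 i) => [i' ->|->].
  have /matrixP/(_ i' j) := Ac; rewrite !mxE => Ac0; rewrite -[RHS]Ac0.
  by apply: eq_bigr => l _; rewrite mxE.
by rewrite mxE big1 // => l _; have /negPn/eqP-> := A0 l; rewrite mul0r.
Qed.

Section Modules.
Variables (D : comNzRingType) (M : lmodType D).

Lemma span_range k (v : 'I_k -> M) x :
  Defs.span (range v) x <-> exists c, x = \sum_i c i *: v i.
Proof.
split=> [[l [c [s [vs ->]]]]|[c ->]]; last first.
  by exists k, c, v; split=> // i; exists i.
have {vs} /choice[t vt] i : exists t, v t = s i.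
  by have [t _ <-] := vs i; exists t.
exists (fun i => \sum_(j | t j == i) c j).
under [RHS]eq_bigr do rewrite scaler_suml.
rewrite (exchange_big_dep xpredT) //=; apply: eq_bigr => j _.
by rewrite (big_pred1 (t j)) ?vt // => i; rewrite eq_sym.
Qed.

Section SubmoduleOf.
Variable S : set M.
Hypothesis S0 : S 0.
Hypothesis SZD : forall a x y, S x -> S y -> S (a *: x + y).

Definition submod_pred : {pred M} := fun x => `[< S x >].

Lemma submod_pred_closed : submod_closed submod_pred.
Proof.
split; first exact/asboolP.
by move=> a x y /asboolP Sx /asboolP Sy; apply/asboolP; apply: SZD.
Qed.

Definition submodule_of : submodClosed M :=
  HB.pack submod_pred
    (GRing.isSubmodClosed.Build D M submod_pred submod_pred_closed).

Lemma submodule_exists : exists P : submodClosed M, forall x, x \in P <-> S x.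
Proof. by exists submodule_of => x; split=> /asboolP. Qed.

End SubmoduleOf.

Lemma linear_pack (N : lmodType D) (f : M -> N) :
  linear f -> exists h : {linear M -> N}, forall x, h x = f x.
Proof.
move=> lf; pose H := GRing.isLinear.Build D M N *:%R f lf.
by exists (HB.pack f H : {linear M -> N}).
Qed.

Lemma basis_coordinates m :
  free_of_rank M m -> exists (phi : 'cV[D]_m -> M) (psi : M -> 'cV[D]_m),
    [/\ linear phi, linear psi, cancel phi psi & cancel psi phi].
Proof.
move=> [e [inde spane]].
pose phi (y : 'cV[D]_m) := \sum_i y i 0 *: e i.
have lphi : linear phi.
  move=> a x y; rewrite /phi scaler_sumr -big_split; apply: eq_bigr => i _.
  by rewrite !mxE scalerDl scalerA.
have /choice[psi psiK] x : exists y, phi y = x.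
  have /span_range[c ->] : Defs.span (range e) x by rewrite spane.
  by exists (\col_i c i); apply: eq_bigr => i _; rewrite mxE.
have phi_inj : injective phi.
  move=> x y xy; apply/matrixP=> i j; rewrite ord1.
  apply/eqP; rewrite -subr_eq0; apply/eqP.
  apply: (inde (fun i => x i 0 - y i 0)).
  under eq_bigr do rewrite scalerBl.
  by rewrite sumrB -/(phi x) -/(phi y) xy subrr.
exists phi, psi; split=> // [a x y|x]; apply: phi_inj; last by rewrite psiK.
by rewrite lphi !psiK.
Qed.

End Modules.

Lemma decreasing_threshold (P : nat -> Prop) m :
  (forall i, (i.+1 < m)%N -> P i.+1 -> P i) ->
  exists2 n, (n <= m)%N & forall j, (j < m)%N -> P j <-> (j < n)%N.
Proof.
elim: m P => [|m IHm] P Pdec; first by exists 0%N.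
have [P0|nP0] := pselect (P 0%N); last first.
  exists 0%N => // j jm; split=> //.
  elim: j jm => [_ /nP0 //|j IHj] jm Pj.
  exact: IHj (ltnW jm) (Pdec _ jm Pj).
have [i|n nm Pn] := IHm (fun i => P i.+1); first by apply: (Pdec i.+1).
by exists n.+1 => // -[|j] jm; [split | apply: Pn].
Qed.

Section FromSplitting.
Variable D : idomainType.

(** On the image of a matrix of rank one, each coordinate that belongs to a
    nonzero row is injective. *)
Lemma rank1_row m (E : 'M[D]_m) (x : 'cV_m) i l :
  rank1_mx E -> E i l != 0 -> E *m x = x -> x i 0 = 0 -> x = 0.
Proof.
move=> rE Eil Ex xi; apply/matrixP=> k j; rewrite ord1 mxE.
apply: (mulfI Eil); rewrite mulr0 -{1}Ex mxE mulr_sumr.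
under eq_bigr do rewrite mulrA (rE i k l) mulrAC.
rewrite -mulr_suml; have := xi; rewrite -{1}Ex mxE => ->; exact: mul0r.
Qed.

Lemma rank1_neq0 m (E : 'M[D]_m) :
  \tr E = 1 -> exists i l, E i l != 0.
Proof.
move=> trE; apply/not_existsP=> E0.
have /eqP := trE; rewrite /mxtrace big1 1?eq_sym ?oner_eq0 // => i _.
by apply/eqP/negP=> /negP Eii; apply: (E0 i); exists i.
Qed.

Lemma rank1_dependent m (E : 'M[D]_m) (x y : 'cV_m) i :
  rank1_mx E -> E *m x = x -> E *m y = y -> y i 0 *: x = x i 0 *: y.
Proof.
move=> rE Ex Ey; apply/matrixP=> k j; rewrite ord1 !mxE.
rewrite -{1}Ey -{1}Ex -{2}Ey -{2}Ex !mxE !mulr_suml.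
under eq_bigr do rewrite mulr_sumr.
under [RHS]eq_bigr do rewrite mulr_sumr.
rewrite exchange_big; apply: eq_bigr => a _; apply: eq_bigr => b _ /=.
transitivity (E i b * E k a * (x a 0 * y b 0)); first by ring.
by rewrite (rE i k b a); ring.
Qed.

End FromSplitting.

(** The module is a direct summand of the free module [M]: a lift defined on a
    basis of [M] is restricted to it. *)
Lemma projective_summand (D : comNzRingType) m (M : lmodType D)
    (phi : 'cV[D]_m -> M) (psi : M -> 'cV[D]_m) (P : submodClosed M)
    (E : 'M[D]_m) :
  linear phi -> linear psi -> cancel psi phi -> cancel phi psi ->
  (forall x, x \in P <-> E *m psi x = psi x) -> E *m E = E ->
  projective (submod P).
Proof.
move=> lphi lpsi psiK phiK memP EE A B g f surj.
have [phi' phi'E] := linear_pack lphi.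
have Pphi y : phi (E *m y) \in P by apply/memP; rewrite phiK mulmxA EE.
pose p (i : 'I_m) : submod P := exist _ (phi (E *m delta_mx i 0)) (Pphi _).
have /choice[a ga] i : exists a, g a = f (p i) by apply: surj.
have [|h hE] := @linear_pack D (submod P) A
  (fun x => \sum_i psi (val x) i 0 *: a i).
  move=> c x y; rewrite scaler_sumr -big_split; apply: eq_bigr => i _ /=.
  by rewrite lpsi !mxE scalerDl scalerA.
exists h => x; rewrite hE linear_sum.
under eq_bigr do rewrite linearZZ ga -linearZZ.
rewrite -linear_sum; congr (f _); apply: val_inj.
have /memP Ex : val x \in P by case: x.
transitivity (phi (E *m psi (val x))); last by rewrite Ex psiK.
rewrite raddf_sum.
have -> : E *m psi (val x) =
    \sum_i psi (val x) i 0 *: (E *m delta_mx i 0).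
  rewrite [in LHS](matrix_sum_delta (psi (val x))) mulmx_sumr.
  by apply: eq_bigr => i _; rewrite big_ord1 scalemxAr.
rewrite -phi'E linear_sum; apply: eq_bigr => i _.
by rewrite linearZZ phi'E.
Qed.

Section StackedBases.
Variable D : idomainType.

Lemma rank1_summand m (M : lmodType D) (phi : 'cV[D]_m -> M)
    (psi : M -> 'cV[D]_m) (P : submodClosed M) (E : 'M[D]_m) :
  linear phi -> linear psi -> cancel psi phi -> cancel phi psi ->
  (forall x, x \in P <-> E *m psi x = psi x) -> rank1_mx E -> \tr E = 1 ->
  has_rank (submod P) 1.
Proof.
move=> lphi lpsi psiK phiK memP rE trE.
have EE : E *m E = E by rewrite rank1_mulmx2 // trE scale1r.
have [phi' phi'E] := linear_pack lphi.
have [psi' psi'E] := linear_pack lpsi.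
have memE (x : submod P) : E *m psi (val x) = psi (val x).
  by apply/memP; case: x.
split.
  have [i [l Eil]] := rank1_neq0 trE.
  have Pl : phi (col l E) \in P.
    by apply/memP; rewrite phiK colE mulmxA EE.
  pose p : submod P := exist (fun x => x \in P) _ Pl.
  exists (fun=> p) => c; rewrite big_ord1.
  move=> /(congr1 (fun x : submod P => psi' (val x) i 0)) /=.
  rewrite linear0 linearZZ psi'E phiK !mxE => /eqP.
  by rewrite mulf_eq0 (negPf Eil) orbF => /eqP c0 k; rewrite ord1.
case=> [|[|k]] // v indv; exfalso.
pose x0 := psi (val (v 0)); pose x1 := psi (val (v (lift 0 0))).
have xx i : x1 i 0 *: x0 = x0 i 0 *: x1.
  by apply: rank1_dependent rE _ _; apply: memE.
have x00 i : x0 i 0 = 0.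
  have := indv (fun k => if k == 0 then x1 i 0 else
                         if k == lift 0 0 then - x0 i 0 else 0).
  move=> /(_ _ (lift 0 0)) /= h; apply/eqP; rewrite -oppr_eq0; apply/eqP.
  apply: h; rewrite !big_ord_recl /= big1 => [|j _]; last first.
    by rewrite scale0r.
  apply: val_inj; apply: (can_inj psiK); rewrite -!psi'E !raddfD /= !raddf0.
  by rewrite addr0 !linearZZ !psi'E -/x0 -/x1 xx scaleNr subrr.
have /indv/(_ 0)/eqP : \sum_i (if i == 0 then 1 else 0) *: v i = 0.
  rewrite big_ord_recl /= big1 => [|j _]; last by rewrite scale0r.
  apply: val_inj; apply: (can_inj psiK); rewrite -!psi'E !raddfD /= !raddf0.
  rewrite addr0 linearZZ psi'E -/x0 scale1r.
  by apply/matrixP=> i j; rewrite ord1 x00 mxE.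
by rewrite /= oner_eq0.
Qed.

Hypothesis arithD : arithmetical D.
Hypothesis splitD : rank1_splitting D.
Hypothesis charD : forall n, n.+1%:R != 0 :> D.

(** The decomposition of the identity matrix is transported to [M] along the
    coordinates of a basis; zero ideals have to be dropped from the chain. *)
Theorem stacked_bases_of_splitting : stacked_bases D.
Proof.
move=> m n le_nm M N /basis_coordinates[phi [psi [lphi lpsi phiK psiK]]].
move=> [s [v spanv]] [[w indw] rkN].
have [phi' phi'E] := linear_pack lphi.
have [psi' psi'E] := linear_pack lpsi.
have psi_inj : injective psi := can_inj psiK.
pose B := \matrix_(i < m, k < s) psi (val (v k)) i 0.
have BE (c : 'I_s -> D) : B *m (\col_k c k) = psi (\sum_k c k *: val (v k)).
  rewrite -psi'E linear_sum; apply/matrixP=> i j; rewrite ord1 mxE summxE.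
  by apply: eq_bigr => k _; rewrite linearZZ !mxE psi'E mulrC.
have memN x : x \in N <-> exists y, psi x = B *m y.
  split=> [Nx|[y]].
    pose x' : submod N := exist (fun x => x \in N) x Nx.
    have /span_range[c cE] : Defs.span (range v) x' by rewrite spanv.
    exists (\col_k c k); rewrite BE; congr (psi _).
    have := congr1 val cE; rewrite raddf_sum /= => ->.
    by apply: eq_bigr => k _.
  have -> : y = \col_k y k 0 by apply/matrixP=> i j; rewrite ord1 mxE.
  rewrite BE => /psi_inj ->; apply: rpred_sum => k _; apply: rpredZ.
  exact: (valP (v k)).
have [|||E [G [EE sE rE GG [_ NB]]]] :=
  @stacked_idempotents D arithD splitD charD m m s 1%:M B.
- exact: mulmx1.
- exact: mul1mx.
- exact: mxtrace1.
have idE i : (i < m)%N -> E i *m E i = E i by move=> im; rewrite EE // eqxx.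
have /choice[Pi memP] (i : 'I_m) : exists P : submodClosed M,
    forall x, x \in P <-> E i *m psi x = psi x.
  apply: (@submodule_exists _ _ [set x | E i *m psi x = psi x]%classic) => /=.
    by rewrite -psi'E linear0 mulmx0.
  move=> a x y; rewrite -!psi'E linearP !psi'E => Ex Ey.
  by rewrite mulmxDr -scalemxAr Ex Ey.
have /choice[Id memI] (j : 'I_n) : exists I : ideal D,
    forall x, x \in I <-> in_cont (G j) x.
  apply: (@submodule_exists _ D^o [set x : D^o | in_cont (G j) x]%classic).
    exact: in_cont0.
  move=> a x y Gx Gy; apply: in_contD => //; exact: in_contM.
(* The rank of N is the number of nonzero ideals in the chain. *)
have [k km Gk] : exists2 k, (k <= m)%N &
    forall j, (j < m)%N -> (exists2 a, in_cont (G j) a & a != 0) <-> (j < k)%N.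
  by apply: decreasing_threshold => i im [a Ga a0]; exists a => //; apply: GG.
have G0 j a : (j < m)%N -> (k <= j)%N -> in_cont (G j) a -> a = 0.
  move=> jm kj Ga; apply/eqP/negP=> /negP a0.
  have /(Gk j jm) : exists2 a, in_cont (G j) a & a != 0 by exists a.
  by rewrite ltnNge kj.
have memNE x : x \in N <-> forall j i, (j < m)%N ->
    in_cont (G j) ((E j *m psi x) i 0).
  split=> [/memN/NB[]//|Gx]; apply/memN/NB; split=> //; exact: mul1mx.
have kn : (k <= n)%N.
  have lt (j : 'I_k) : (j < m)%N := leq_trans (ltn_ord j) km.
  have /choice[p pE] (j : 'I_k) : exists p : 'cV_m, E j *m p = p /\ p != 0.
    have [_ /rank1_neq0[i [l Eil]]] := rE j (lt j).
    exists (col l (E j)); split; first by rewrite colE mulmxA idE.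
    by apply: contraNneq Eil => /matrixP/(_ i 0); rewrite !mxE => ->.
  have /choice[a aE] (j : 'I_k) : exists a, in_cont (G j) a /\ a != 0.
    by have /(Gk j (lt j))[a Ga a0] := ltn_ord j; exists a.
  have Ep (l : nat) (j : 'I_k) : (l < m)%N ->
      E l *m p j = if l == j then p j else 0.
    move=> lm; have [<- _] := pE j; rewrite mulmxA EE //.
    by case: eqP => [->|_] //; rewrite mul0mx.
  have Nx j : phi (a j *: p j) \in N.
    apply/memNE => l i lm; rewrite phiK -scalemxAr Ep //.
    case: eqP => [->|_]; last by rewrite scaler0 mxE; apply: in_cont0.
    by rewrite mxE mulrC; apply: in_contM; have [] := aE j.
  pose q j : submod N := exist (fun x => x \in N) _ (Nx j).
  apply: (rkN k q) => c c0 j.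
  have /(congr1 (fun x : submod N => E j *m psi' (val x))) := c0.
  rewrite (raddf_sum val) /= linear0 mulmx0 linear_sum mulmx_sumr.
  rewrite (bigD1 j) //= big1 => [|l lj]; last first.
    rewrite linearZZ psi'E phiK -!scalemxAr Ep //.
    by rewrite eq_sym val_eqE (negPf lj) !scaler0.
  rewrite addr0 linearZZ psi'E phiK -!scalemxAr Ep // eqxx => /matrixP cap.
  have [_ /eqP p0] := pE j; have [_ a0] := aE j.
  apply/eqP/negP=> /negP cj; apply: p0; apply/matrixP=> i i'.
  have /eqP := cap i i'; rewrite !mxE !mulf_eq0 (negPf cj) (negPf a0).
  by move/eqP.
have nk : (n <= k)%N.
  rewrite leqNgt; apply/negP=> kn'.
  have lt (j : 'I_k) : (j < m)%N := leq_trans (ltn_ord j) km.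
  have /choice[i_ /choice[l_ Eil]] (j : 'I_k) : exists i l, E j i l != 0.
    by apply: rank1_neq0; have [] := rE j (lt j).
  pose A := \matrix_(j < k, t < n) (E j *m psi (val (w t))) (i_ j) 0.
  have [c /eqP c0 Ac] := kernel_wide A kn'.
  pose x := \sum_t c t 0 *: w t.
  have Ex j : (j < m)%N -> E j *m psi (val x) = 0.
    move=> jm; have [kj|jk] := leqP k j.
      have /memNE Nx : val x \in N by apply: (valP x).
      by apply/matrixP=> i i'; rewrite ord1 [RHS]mxE; apply: (G0 j) => //; apply: Nx.
    have [rEj _] := rE j jm.
    apply: (rank1_row rEj (Eil (Ordinal jk))); first by rewrite mulmxA idE.
    have Ac0 : (A *m c) (Ordinal jk) 0 = 0 by rewrite Ac mxE.
    rewrite -[RHS]Ac0 [RHS]mxE -psi'E (raddf_sum val) linear_sum mulmx_sumr.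
    rewrite summxE; apply: eq_bigr => t _ /=.
    by rewrite linearZZ -scalemxAr psi'E mxE mulrC [A _ _]mxE.
  apply: c0; apply/matrixP=> t i; rewrite ord1 mxE.
  apply: (indw (fun t => c t 0)); apply: val_inj; apply: psi_inj.
  rewrite -[RHS]psi'E linear0 -[psi _]mul1mx -sE mulmx_suml big1 // => j _.
  exact: Ex.
have ekn : k = n by apply/eqP; rewrite eqn_leq kn nk.
subst k.
have dsum0 k (lekm : (k <= m)%N) (y : 'I_k -> M) :
    (forall i, y i \in Pi (widen_ord lekm i)) -> \sum_i y i = 0 ->
    forall i, y i = 0.
  move=> Py y0 i; have lt (j : 'I_k) : (j < m)%N := leq_trans (ltn_ord j) lekm.
  have /(congr1 (fun x => E i *m psi' x)) := y0.
  rewrite linear0 mulmx0 linear_sum mulmx_sumr (bigD1 i) //= big1.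
    have /memP /= Ey := Py i; rewrite addr0 psi'E Ey => /(congr1 phi).
    by rewrite psiK -phi'E linear0.
  move=> j ji; have /memP /= Ey := Py j; rewrite psi'E -Ey mulmxA EE //.
  by rewrite ifN ?mul0mx // eq_sym val_eqE.
have smulP (j : 'I_n) (i : 'I_m) x : ideal_smul (Id j) (Pi i) x <->
    E i *m psi x = psi x /\ forall l, in_cont (G j) (psi x l 0).
  split=> [[l [c [t [ts ->]]]]|[Ex Gx]]; last first.
    exists m, (fun=> 1), (fun l => psi x l 0 *: phi (col l (E i))); split.
      move=> l; exists (psi x l 0), (phi (col l (E i))); split; first exact/memI.
      by split=> //; apply/memP; rewrite phiK colE mulmxA idE.
    rewrite -[LHS]psiK -{1}Ex [in LHS](matrix_sum_delta (psi x)) mulmx_sumr.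
    rewrite -phi'E linear_sum; apply: eq_bigr => l _.
    by rewrite big_ord1 -scalemxAr linearZZ phi'E colE scale1r.
  split.
    rewrite -psi'E linear_sum mulmx_sumr; apply: eq_bigr => u _.
    have [a [p [_ [/memP Pp ->]]]] := ts u.
    by rewrite scalerA linearZZ psi'E -scalemxAr Pp.
  move=> u; rewrite -psi'E linear_sum summxE; apply: in_cont_sum => v' _.
  have [a [p [Ia [/memP Pp ->]]]] := ts v'.
  by rewrite scalerA linearZZ mxE mulrAC; apply: in_contM; apply/memI.
exists Pi, Id; split; last (split; last (split; last (split; last first))).
- move=> i; have [rEi tEi] := rE i (ltn_ord i); split.
    by apply: (projective_summand lphi lpsi psiK phiK (memP i)); apply: idE.
  exact: (rank1_summand lphi lpsi psiK phiK (memP i)).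
- move=> j; have jm : (j < m)%N by apply: leq_trans (ltn_ord j) le_nm.
  by have /(Gk j jm)[a Ga a0] := ltn_ord j; exists a => //; apply/memI.
- split.
    apply/seteqP; split=> x //= _.
    exists (fun i => phi (E i *m psi x)); split=> [i|].
      by apply/memP; rewrite phiK mulmxA idE.
    rewrite -[LHS]psiK -{1}[psi x]mul1mx -sE mulmx_suml -phi'E linear_sum.
    by apply: eq_bigr => i _; rewrite phi'E.
  move=> y Py y0 i; apply: (dsum0 m (leqnn m) y) => // j.
  by have -> : widen_ord (leqnn m) j = j; [apply: val_inj | apply: Py].
- move=> j j' jj' a /memI Ga; apply/memI.
  apply: GG; first by rewrite -jj'; apply: leq_trans (ltn_ord j') le_nm.
  by rewrite -jj'.
split; last first.
  move=> y Py y0; apply: (dsum0 n le_nm) => // i.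
  by have /smulP[Ey _] := Py i; apply/memP.
apply/seteqP; split=> x /=.
  move=> Nx; have /memNE Gx := Nx.
  exists (fun j => phi (E j *m psi x)); split=> [j|].
    have jm : (j < m)%N by apply: leq_trans (ltn_ord j) le_nm.
    by apply/smulP; rewrite phiK mulmxA idE //; split=> // l; apply: Gx.
  rewrite -[LHS]psiK -{1}[psi x]mul1mx -sE mulmx_suml -phi'E linear_sum.
  rewrite (big_ord_widen _ (fun j => phi (E j *m psi x)) le_nm).
  rewrite [RHS]big_mkcond /=; apply: eq_bigr => j _; rewrite -!phi'E.
  case: ltnP => // nj.
  suff -> : E j *m psi x = 0 by rewrite linear0.
  by apply/matrixP=> i i'; rewrite ord1 [RHS]mxE; apply: (G0 j) => //; apply: Gx.
move=> [y [Iy ->]]; apply/memNE => j i jm.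
rewrite -psi'E linear_sum mulmx_sumr summxE; apply: in_cont_sum => l _.
have /smulP[/= Ey Gy] := Iy l; rewrite psi'E.
have lm : (l < m)%N by apply: leq_trans (ltn_ord l) le_nm.
rewrite -Ey mulmxA EE //; case: eqP => [->|_]; first by rewrite Ey.
by rewrite mul0mx mxE; apply: in_cont0.
Qed.
End StackedBases.

(** * Stacked bases imply the criterion *)

Section TwoByTwo.
Variable D : comNzRingType.

Lemma ord2P (P : 'I_2 -> Prop) : P 0 -> P 1 -> forall i, P i.
Proof.
move=> P0 P1 i; have [->//|->//] : i = 0 \/ i = 1.
by case: i => [[|[|]]] //= ?; [left|right]; apply: val_inj.
Qed.

Lemma sum2E (V : nmodType) (F : 'I_2 -> V) : \sum_i F i = F 0 + F 1.
Proof.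
by rewrite !big_ord_recl big_ord0 addr0; congr (_ + F _); apply: val_inj.
Qed.

Lemma det2E (A : 'M[D]_2) : \det A = A 0 0 * A 1 1 - A 0 1 * A 1 0.
Proof.
rewrite (expand_det_row _ 0) sum2E /cofactor !det_mx11 !mxE /=.
have -> : lift 0 0 = 1 :> 'I_2 by apply: val_inj.
have -> : lift 1 0 = 0 :> 'I_2 by apply: val_inj.
by rewrite expr0 expr1; ring.
Qed.

Lemma det2_rank1 (A : 'M[D]_2) : \det A = 0 <-> rank1_mx A.
Proof.
rewrite det2E; split=> [/eqP|rA]; last first.
  by rewrite (rA 0 1 0 1) mulrC subrr.
rewrite subr_eq0 => /eqP dA; do 4!apply: ord2P => //.
all: first [by rewrite mulrC | by rewrite dA | by rewrite -dA mulrC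
  | by rewrite mulrC dA mulrC | by rewrite mulrC -dA mulrC].
Qed.

Lemma contP m n (A : 'M[D]_(m, n)) x : cont A x <-> in_cont A x.
Proof.
split=> [[k [c [s [sA ->]]]]|[Y ->]].
  apply: in_cont_sum => i _; apply: in_contM.
  by have [a [b ->]] := sA i; apply: in_cont_entry.
exists #|{: 'I_m * 'I_n}|, (fun k => let: (i, j) := enum_val k in Y j i),
  (fun k => A (enum_val k).1 (enum_val k).2); split.
  by move=> k; exists (enum_val k).1, (enum_val k).2.
rewrite /mxtrace.
under eq_bigr do rewrite mxE.
rewrite pair_bigA (reindex (@enum_val _ {: 'I_m * 'I_n})) /=; last first.
  exact: onW_bij (enum_val_bij _).
by apply: eq_bigr => k _; case: (enum_val k) => i j; rewrite mulrC.
Qed.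

Lemma cont_full m n (A : 'M[D]_(m, n)) :
  cont A = [set: D]%classic <-> exists Y : 'M_(n, m), \tr (A *m Y) = 1.
Proof.
split=> [A1|[Y trY]].
  have /contP[Y trY] : cont A 1 by rewrite A1.
  by exists Y.
apply/seteqP; split=> // x _; apply/contP; rewrite -[x]mulr1 -trY.
by apply: in_contM; exists Y.
Qed.
End TwoByTwo.

(** If [im B = I_0 P_0 + I_1 P_1] is a stacked decomposition of the column space
    of a matrix of unit content, then the entries of [B] lie in [I_0], so that
    [I_0] is the unit ideal and [P_0] lies in the column space. The projection
    [E] onto [P_0] is therefore a multiple of [B]; it is a nonzero idempotent
    of determinant zero, so its trace is 1 and its content the unit ideal. *)
Lemma stacked_bases_criterion (D : idomainType) (B : 'M[D]_2) :
  stacked_bases D -> cont B = [set: D]%classic ->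
  exists C : 'M[D]_2, cont (B *m C) = [set: D]%classic /\ \det (B *m C) = 0.
Proof.
move=> SB contB; have [dB0|dB] := eqVneq (\det B) 0.
  by exists 1%:M; rewrite mulmx1.
have [Y trY] := (cont_full B).1 contB.
have [N memN] : exists N : submodClosed 'cV[D]_2,
    forall x, x \in N <-> exists y, x = B *m y.
  apply: (@submodule_exists _ _ [set x | exists y, x = B *m y]%classic) => /=.
    by exists 0; rewrite mulmx0.
  move=> a _ _ [y ->] [z ->]; exists (a *: y + z).
  by rewrite mulmxDr scalemxAr.
have Binj (c : 'cV_2) : B *m c = 0 -> c = 0.
  move=> /(congr1 (mulmx (\adj B))); rewrite mulmxA mul_adj_mx mulmx0.
  by rewrite mul_scalar_mx -[RHS](scaler0 _ (\det B)) => /(scalemx_inj dB).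
have freeM : free_of_rank 'cV[D]_2 2.
  exists (fun i => delta_mx i 0); split.
    move=> c /matrixP c0 i; have := c0 i 0; rewrite summxE (bigD1 i) //= big1.
      by rewrite !mxE !eqxx mulr1 addr0.
    by move=> j /negPf ji; rewrite !mxE eq_sym ji mulr0.
  apply/seteqP; split=> // x _; apply/span_range; exists (fun i => x i 0).
  rewrite {1}[x]matrix_sum_delta; apply: eq_bigr => i _.
  by rewrite big_ord1.
have colN k : col k B \in N by apply/memN; exists (delta_mx k 0); rewrite colE.
pose v k : submod N := exist (fun x => x \in N) _ (colN k).
have sumv (c : 'I_2 -> D) : val (\sum_i c i *: v i) = B *m \col_k c k.
  rewrite (raddf_sum val) /=; apply/matrixP=> i j; rewrite ord1 summxE mxE.
  by apply: eq_bigr => k _; rewrite !mxE mulrC.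
have fgN : fin_gen (submod N).
  exists 2, v; apply/seteqP; split=> // x _; apply/span_range.
  have /memN[y xE] := valP x; exists (fun i => y i 0); apply: val_inj.
  rewrite sumv xE; congr (_ *m _); apply/matrixP=> i j.
  by rewrite ord1 mxE.
have rkN : has_rank (submod N) 2.
  split.
    exists v => c /(congr1 val); rewrite sumv => /Binj/matrixP c0 i.
    by have := c0 i 0; rewrite !mxE.
  move=> k w indw; rewrite leqNgt; apply/negP=> k2.
  have [c /eqP c0 wc] :=
    kernel_wide (\matrix_(i < 2, t < k) (val (w t) : 'cV_2) i 0) k2.
  apply: c0; apply/matrixP=> t i; rewrite ord1 mxE.
  apply: (indw (fun t => c t 0)); apply: val_inj.
  rewrite (raddf_sum val) /=; apply/matrixP=> a b; rewrite ord1 summxE.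
  have /matrixP/(_ a 0) := wc; rewrite !mxE => wc0; rewrite -[RHS]wc0.
  by apply: eq_bigr => s _; rewrite !mxE mulrC.
have [P [I [rkP [_ [[dsM uniqM] [[dsN _] chain]]]]]] :=
  SB 2 2 (leqnn 2) _ N freeM fgN rkN.
have {}uniqM y0 y1 : y0 \in P 0 -> y1 \in P 1 -> y0 + y1 = 0 -> y0 = 0.
  move=> Py0 Py1 y01; pose y (i : 'I_2) := if i == 0 then y0 else y1.
  by apply: (uniqM y _ _ 0); [apply: ord2P | rewrite sum2E].
have wid (j : 'I_2) : widen_ord (leqnn 2) j = j by apply: val_inj.
have smulI j x l : ideal_smul (I j) (P j) x -> (x : 'cV[D]_2) l 0 \in I j.
  move=> [k [c [s [sI ->]]]]; rewrite summxE; apply: rpred_sum => i _.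
  have [a [p [Ia [_ ->]]]] := sI i; rewrite !mxE [a * _]mulrC.
  by apply: rpredZ; apply: rpredZ.
have NI x l : x \in N -> (x : 'cV[D]_2) l 0 \in I 0.
  move=> Nx; have : [set` N]%classic x by [].
  rewrite dsN => -[y [Iy ->]]; rewrite sum2E mxE.
  apply: rpredD; first by apply: smulI; have := Iy 0; rewrite wid.
  by apply: (chain 0 1) => //; apply: smulI; have := Iy 1; rewrite wid.
have I1 : (1 : D^o) \in I 0.
  rewrite -trY; apply: rpred_sum => i _; rewrite mxE; apply: rpred_sum => k _.
  rewrite mulrC; apply: rpredZ; have := NI _ i (colN k); by rewrite mxE.
have PN p : p \in P 0 -> p \in N.
  move=> Pp; suff : [set` N]%classic p by [].
  rewrite dsN; exists (fun i => if i == 0 then p else 0); split; last first.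
    by rewrite sum2E /= addr0.
  apply: ord2P; rewrite wid /=.
    exists 1, (fun=> 1), (fun=> p); split; last by rewrite big_ord1 scale1r.
    by move=> _; exists 1, p; rewrite scale1r.
  exists 0, (fun=> 0), (fun=> 0); split; first by case.
  by rewrite big_ord0.
have /choice[q qP] i : exists q, q \in P 0 /\ delta_mx i 0 - q \in P 1.
  have : [set: 'cV[D]_2]%classic (delta_mx i 0) by [].
  rewrite dsM => -[y [Py yE]]; exists (y 0); split; first exact: (Py 0).
  by rewrite yE sum2E addrAC subrr add0r; apply: (Py 1).
have /choice[C0 C0E] i : exists y, q i = B *m y.
  by apply/memN; apply: PN; have [] := qP i.
pose E : 'M[D]_2 := \matrix_(k, i) q i k 0.
pose C : 'M[D]_2 := \matrix_(k, i) C0 i k 0.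
have BC : B *m C = E.
  apply/matrixP=> k i; rewrite !mxE C0E mxE; apply: eq_bigr => j _.
  by rewrite !mxE.
have Eq (x : 'cV_2) : E *m x = \sum_i x i 0 *: q i.
  apply/matrixP=> k j; rewrite ord1 mxE summxE; apply: eq_bigr => i _.
  by rewrite !mxE mulrC.
have EP x : E *m x \in P 0.
  by rewrite Eq; apply: rpred_sum => i _; apply: rpredZ; have [] := qP i.
have EP' x : x - E *m x \in P 1.
  rewrite Eq {1}[x]matrix_sum_delta -sumrB; apply: rpred_sum => i _.
  by rewrite big_ord1 -scalerBr; apply: rpredZ; have [] := qP i.
have Ep p : p \in P 0 -> E *m p = p.
  move=> Pp; apply/eqP; rewrite eq_sym -subr_eq0; apply/eqP.
  apply: (uniqM _ (- (p - E *m p))); last by rewrite subrr.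
    by rewrite -scaleN1r; apply: rpredD => //; apply: rpredZ.
  by rewrite -scaleN1r; apply: rpredZ; apply: EP'.
have [_ [[w indw] dimP]] := rkP 0.
have E0 : E != 0.
  apply/eqP=> E0; have /indw/(_ 0)/eqP : \sum_i 1 *: w i = 0.
    rewrite big_ord1 scale1r; apply: val_inj => /=.
    by rewrite -(Ep _ (valP (w 0))) E0 mul0mx.
  by rewrite oner_eq0.
have EE : E *m E = E.
  apply/matrixP=> k i; have /Ep/matrixP/(_ k 0) := (qP i).1.
  by rewrite [E k i]mxE => <-; rewrite !mxE; apply: eq_bigr => j _; rewrite !mxE.
have detE : \det E = 0.
  pose u i : submod (P 0) := exist (fun x => x \in P 0) _ (qP i).1.
  apply/eqP/negP=> /negP dE; suff indu : lin_indep u by have := dimP 2 u indu.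
  move=> c /(congr1 val); rewrite (raddf_sum val) /= => qc i.
  have : E *m \col_k c k = 0.
    by rewrite Eq -[RHS]qc; apply: eq_bigr => k _; rewrite mxE.
  move=> /(congr1 (mulmx (\adj E))); rewrite mulmxA mul_adj_mx mulmx0.
  rewrite mul_scalar_mx -[RHS](scaler0 _ (\det E)) => /(scalemx_inj dE).
  by move/matrixP/(_ i 0); rewrite !mxE.
exists C; rewrite BC; split=> //; apply/cont_full; exists 1%:M; rewrite mulmx1.
have /det2_rank1/rank1_mulmx2 := detE; rewrite EE => /esym/eqP.
rewrite -{3}[E]scale1r -subr_eq0 -scalerBl => /eqP sE.
apply/eqP; rewrite -subr_eq0; apply: contra_neqT E0 => tr1.
by apply: (scalemx_inj tr1); rewrite sE scaler0.
Qed.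

(** * Residues of the ring of integers modulo a prime number *)

Section IntegerRing.
Variable K : fieldExtType rat.
Local Notation O := (@OK K).

Lemma natr_neq0 n : (0 < n)%N -> n%:R != 0 :> K.
Proof.
move=> n0; rewrite -(rmorph_nat (in_alg K)) fmorph_eq0.
by rewrite Num.Theory.pnatr_eq0 -lt0n.
Qed.

Lemma intr_K_inj : injective (intr : int -> K).
Proof.
move=> z1 z2 /eqP; rewrite -subr_eq0 -rmorphB /= => z0; apply/eqP.
rewrite -subr_eq0 -absz_eq0 -leqn0 leqNgt; apply/negP=> /natr_neq0/negP; apply.
by rewrite pmulrn abszEsg rmorphM /= (eqP z0) mulr0.
Qed.

Lemma OK_subring : subring_closed O.
Proof.
split=> [|x y /OKP Ox /OKP Oy|x y /OKP Ox /OKP Oy]; apply/OKP.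
- exact: integral1.
- exact: integral_sub.
- exact: integral_mul.
Qed.

HB.instance Definition _ := GRing.isSubringClosed.Build K O OK_subring.

Lemma OK0 : 0 \in O. Proof. exact: rpred0. Qed.
Lemma OK1 : 1 \in O. Proof. exact: rpred1. Qed.
Lemma OKD x y : x \in O -> y \in O -> x + y \in O.
Proof. exact: rpredD. Qed.
Lemma OKB x y : x \in O -> y \in O -> x - y \in O.
Proof. exact: rpredB. Qed.
Lemma OKM x y : x \in O -> y \in O -> x * y \in O.
Proof. exact: rpredM. Qed.
Lemma OKX x n : x \in O -> x ^+ n \in O.
Proof. exact: rpredX. Qed.
Lemma OK_int z : z%:~R \in O. Proof. exact: rpred_int. Qed.
Lemma OK_nat n : n%:R \in O. Proof. exact: rpred_nat. Qed.
Lemma OK_sum (I : Type) (r : seq I) (P : pred I) (F : I -> K) :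
  (forall i, P i -> F i \in O) -> \sum_(i <- r | P i) F i \in O.
Proof. exact: rpred_sum. Qed.
Lemma OK_prod (I : Type) (r : seq I) (P : pred I) (F : I -> K) :
  (forall i, P i -> F i \in O) -> \prod_(i <- r | P i) F i \in O.
Proof. exact: rpred_prod. Qed.

Lemma OK_root (q : {poly K}) x :
  q \is monic -> root q x -> (forall i, q`_i \in O) -> x \in O.
Proof.
move=> mq qx Oq; apply/OKP; apply: integral_root_monic mq qx _.
by apply/integral_poly => i; have /OKP := Oq i.
Qed.

(** Multiplication of the equation by a power of its leading coefficient makes
    it a monic one for [c n * x]. *)
Lemma OK_lead_root n (c : nat -> K) x :
  (forall i, c i \in O) -> \sum_(i < n.+1) c i * x ^+ i = 0 -> c n * x \in O.
Proof.
move=> Oc; case: n => [|n] cx.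
  by move: cx; rewrite big_ord1 mulr1 => ->; rewrite mul0r rpred0.
pose a := c n.+1; pose q := 'X^(n.+1) + \poly_(i < n.+1) (c i * a ^+ (n - i)).
apply: (@OK_root q).
- by rewrite monicE lead_coefDl ?lead_coefXn // size_polyXn ltnS size_poly.
- rewrite rootE !hornerE horner_poly.
  apply/eqP; transitivity (a ^+ n * \sum_(i < n.+2) c i * x ^+ i).
    rewrite [in RHS]big_ord_recr /= mulrDr -/a mulr_sumr addrC.
    congr (_ + _); last by rewrite exprMn exprS; ring.
    apply: eq_bigr => i _.
    have -> : a ^+ n = a ^+ (n - i) * a ^+ i.
      by rewrite -exprD subnK // -ltnS.
    by rewrite exprMn; ring.
  by rewrite cx mulr0.
- move=> i; rewrite coefD coefXn coef_poly; apply: OKD; first exact: OK_nat.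
  case: ifP => _; last exact: OK0.
  by apply: OKM => //; apply: OKX; apply: Oc.
Qed.

(** More elements than the degree of [K] satisfy an integral relation with
    coprime coefficients; this one fact bounds the size of [O / p], clears
    denominators, and provides the equations that make localizations of [O]
    valuation rings. *)
Lemma integral_relation n (v : 'I_n -> K) : (\dim {:K} < n)%N ->
  exists c : nat -> int, \sum_(i < n) (c i)%:~R * v i = 0 /\
    forall p : nat, prime p -> exists2 i, (i < n)%N & ~~ (p %| c i)%Z.
Proof.
move=> dn; pose X := [tuple v i | i < n].
have nfX : ~ free X.
  rewrite /free size_tuple => /eqP dX.
  by have := dimvS (subvf <<X>>%VS); rewrite dX leqNgt dn.
have [k kX [i0 ki0]] : exists2 k : 'I_n -> rat, \sum_i k i *: v i = 0 &
    exists i, k i != 0.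
  apply: contrapT => nk; apply: nfX; apply/freeP => k kX i.
  apply/eqP/negP=> /negP ki; apply: nk; exists k; last by exists i.
  rewrite -[RHS]kX; apply: eq_bigr => j _.
  by rewrite (nth_map j) ?size_enum_ord // nth_ord_enum.
pose P := \poly_(i < n) (if insub i is Some j then k j else 0).
have Pk (i : 'I_n) : P`_i = k i by rewrite coef_poly ltn_ord valK.
have P0 : P != 0 by apply: contraNneq ki0 => P0; rewrite -Pk P0 coef0.
have [q [a a0 Pq]] := rat_poly_scale P; pose r := zprimitive q.
have q0 : q != 0.
  by apply: contraNneq P0 => q0; rewrite Pq q0 rmorph0 scaler0.
exists (fun i => r`_i); split; last first.
  move=> p pp; apply: contrapT => np.
  have : (p %| zcontents r)%Z.
    rewrite dvdz_contents; apply/polyOverP => i; have [ni|ni] := ltnP i n.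
      by apply: contrapT => /negP pri; apply: np; exists i.
    rewrite nth_default ?dvdz0 // size_zprimitive; apply: leq_trans ni.
    have <- : size P = size q.
      by rewrite Pq size_scale ?invr_eq0 ?intr_eq0 // size_map_inj_poly //;
        apply: intr_inj.
    exact: size_poly.
  rewrite zcontents_primitive q0 dvdz1 absz_nat => /eqP p1.
  by rewrite p1 in pp.
pose l : rat := a%:~R^-1 * (zcontents q)%:~R.
have l0 : l != 0 by rewrite mulf_neq0 ?invr_eq0 ?intr_eq0 ?zcontents_eq0.
have Er (i : 'I_n) : k i = l * (r`_i)%:~R.
  rewrite -Pk Pq coefZ coef_map [q in LHS]zpolyEprim coefZ /= rmorphM /= -/r.
  by rewrite mulrA.
apply: (scalerI l0); rewrite scaler0 -[RHS]kX scaler_sumr.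
apply: eq_bigr => i _; rewrite Er -scalerA scaler_int.
by rewrite mulrzl.
Qed.

Lemma OK_denominator x : exists2 n : nat, (0 < n)%N & n%:R * x \in O.
Proof.
suff root_int n (c : nat -> int) : \sum_(i < n) (c i)%:~R * x ^+ i = 0 ->
    (exists2 i, (i < n)%N & c i != 0) -> exists2 m : int, m != 0 & m%:~R * x \in O.
  have [c [cx /(_ 2 isT)[i ni ci]]] :=
    integral_relation (fun i : 'I_(\dim {:K}).+1 => x ^+ i) (ltnSn _).
  have [|m m0 mx] := root_int _ c cx.
    by exists i => //; apply: contraNneq ci => ->; rewrite dvdz0.
  exists `|m|%N; first by rewrite absz_gt0.
  have -> : (`|m|%N)%:R = (sgz m * m)%:~R :> K by rewrite -abszEsg pmulrn.
  by rewrite rmorphM /= -mulrA; apply: OKM => //; apply: OK_int.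
elim: n => [_ []//|n IHn] cx [i ni ci].
have [cn|cn] := eqVneq (c n) 0; last first.
  by exists (c n) => //; apply: (OK_lead_root (c := fun i => (c i)%:~R)) cx => j;
    apply: OK_int.
apply: IHn; first by move: cx; rewrite big_ord_recr /= cn mul0r addr0.
exists i => //; rewrite ltn_neqAle -ltnS ni andbT.
by apply: contraNneq ci => ->; rewrite cn.
Qed.

Definition OK_dvd (a x : K) := exists2 z, z \in O & x = a * z.

Lemma OK_dvdB a x y : OK_dvd a x -> OK_dvd a y -> OK_dvd a (x - y).
Proof.
by move=> [z Oz ->] [w Ow ->]; exists (z - w); rewrite ?mulrBr //; apply: OKB.
Qed.

Lemma OK_dvdD a x y : OK_dvd a x -> OK_dvd a y -> OK_dvd a (x + y).
Proof.
by move=> [z Oz ->] [w Ow ->]; exists (z + w); rewrite ?mulrDr //; apply: OKD.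
Qed.

Lemma OK_dvdMl a x y : y \in O -> OK_dvd a x -> OK_dvd a (y * x).
Proof.
by move=> Oy [z Oz ->]; exists (y * z); [apply: OKM | rewrite mulrCA].
Qed.

Lemma OK_dvd0 a : OK_dvd a 0.
Proof. by exists 0; rewrite ?mulr0 ?OK0. Qed.

Lemma OK_dvd_sum a (I : Type) (r : seq I) (P : pred I) (F : I -> K) :
  (forall i, P i -> OK_dvd a (F i)) -> OK_dvd a (\sum_(i <- r | P i) F i).
Proof.
by move=> aF; apply: big_ind => //; [apply: OK_dvd0 | apply: OK_dvdD].
Qed.

Lemma OK_dvd_int (m n : int) : (m %| n)%Z -> OK_dvd m%:~R n%:~R.
Proof.
by move=> /dvdzP[q ->]; exists q%:~R; rewrite ?OK_int // rmorphM mulrC.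
Qed.

Section ModuloPrime.
Variable p : nat.
Hypothesis p_prime : prime p.
Local Notation pO := (OK_dvd p%:R).

Lemma prime_inverse (c : int) : ~~ (p %| c)%Z ->
  exists u, pO ((u * c)%:~R - 1).
Proof.
move=> pc; have : coprimez c p.
  by rewrite coprimez_sym coprimezE /= prime_coprime.
move=> /coprimezP[[u v] /= uv]; exists u.
exists (- v%:~R); first by rewrite -rmorphN OK_int.
have -> : u * c = 1 - v * p by rewrite -uv addrK.
by rewrite rmorphB rmorphM /=; ring.
Qed.

(** A family of maximal length that is linearly independent modulo [p] spans
    [O / p] over the prime field. *)
Lemma spanning_residues : exists n (v : 'I_n -> K), (forall i, v i \in O) /\
  forall y, y \in O -> exists c : 'I_n -> int, pO (y - \sum_i (c i)%:~R * v i).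
Proof.
pose indep n (v : 'I_n -> K) := (forall i, v i \in O) /\
  forall c : 'I_n -> int, pO (\sum_i (c i)%:~R * v i) -> forall i, (p %| c i)%Z.
suff main k : forall n (v : 'I_n -> K), (n + k)%N = (\dim {:K}).+1 ->
    indep n v -> exists n (v : 'I_n -> K), (forall i, v i \in O) /\
  forall y, y \in O -> exists c : 'I_n -> int, pO (y - \sum_i (c i)%:~R * v i).
  by apply: (main _ 0%N (fun=> 0) (add0n _)); split=> [[]|c _ []].
elim: k => [|k IHk] n v nk [Ov indv].
  have [|c [cv /(_ p p_prime)[i ni]]] := integral_relation v.
    by rewrite -nk addn0.
  move/negP; case; have := indv (fun i => c i) _ (Ordinal ni); apply.
  by rewrite cv; apply: OK_dvd0.
have [spanv|/existsNP[y /not_implyP[Oy ny]]] := pselect (forall y, y \in O ->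
    exists c : 'I_n -> int, pO (y - \sum_i (c i)%:~R * v i)).
  by exists n, v.
pose w (i : 'I_n.+1) := if unlift ord_max i is Some j then v j else y.
have wl j : w (widen_ord (leqnSn n) j) = v j.
  have -> : widen_ord (leqnSn n) j = lift ord_max j.
    by apply: val_inj; rewrite /= /bump leqNgt ltn_ord.
  by rewrite /w liftK.
have wm : w ord_max = y by rewrite /w unlift_none.
apply: (IHk n.+1 w); first by rewrite addSnnS.
split=> [i|c].
  by rewrite /w; case: unliftP.
rewrite big_ord_recr /= wm => pcw.
have pc : (p %| c ord_max)%Z.
  apply: contrapT => /negP pc; apply: ny; have [u pu] := prime_inverse pc.
  exists (fun i => - (u * c (widen_ord (leqnSn n) i))).
  have := OK_dvdB (OK_dvdMl (OK_int u) pcw) (OK_dvdMl Oy pu).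
  set S := \sum_(i < n) _ => h.
  have -> : \sum_i (- (u * c (widen_ord (leqnSn n) i)))%:~R * v i = - (u%:~R * S).
    rewrite mulr_sumr -sumrN; apply: eq_bigr => i _.
    by rewrite -wl rmorphN rmorphM /=; ring.
  by move: h; congr (pO _); rewrite rmorphM /=; ring.
have pcv : pO (\sum_(i < n) (c (widen_ord (leqnSn n) i))%:~R * v i).
  under eq_bigr do rewrite -wl.
  have := OK_dvdB pcw (OK_dvdMl Oy (OK_dvd_int pc)).
  by rewrite [y * _]mulrC addrK.
move=> i; have [j ->|->//] := unliftP ord_max i.
have := indv _ pcv j; congr (_ %| c _)%Z; apply: val_inj => /=.
by rewrite /bump leqNgt ltn_ord.
Qed.

Lemma finite_residues : exists F : seq K, (forall r, r \in F -> r \in O) /\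
  forall y, y \in O -> exists2 r, r \in F & pO (y - r).
Proof.
have [n [v [Ov spanv]]] := spanning_residues.
pose g (f : {ffun 'I_n -> 'I_p}) : K := \sum_i (f i : nat)%:R * v i.
exists (map g (enum {: {ffun 'I_n -> 'I_p}})); split.
  move=> _ /mapP[f _ ->]; apply: OK_sum => i _; apply: OKM => //.
  exact: OK_nat.
move=> y /spanv[c yc].
have p0 : (p%:Z != 0)%R by rewrite -lt0n prime_gt0.
have lt i : (`|(c i %% p)%Z|%N < p)%N.
  by rewrite -ltz_nat gez0_abs ?modz_ge0 // ltz_pmod // ltz_nat prime_gt0.
pose f : {ffun 'I_n -> 'I_p} := [ffun i => Ordinal (lt i)].
exists (g f); first by apply: map_f; rewrite mem_enum.
have : pO (\sum_i (c i)%:~R * v i - g f).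
  rewrite -sumrB; apply: OK_dvd_sum => i _; rewrite -mulrBl mulrC ffunE /=.
  apply: OK_dvdMl => //.
  have -> : (`|(c i %% p)%Z|%N)%:R = (c i %% p)%Z%:~R :> K.
    by rewrite pmulrn gez0_abs ?modz_ge0.
  rewrite -rmorphB /=; apply: (OK_dvd_int (m := p)).
  by apply/dvdzP; exists (c i %/ p)%Z; rewrite {1}(divz_eq (c i) p) addrK.
by move/(OK_dvdD yc); rewrite addrA subrK.
Qed.

(** The residue ring [O / p] is finite, so the powers of each element become
    periodic, with a period that can be chosen once and for all. *)
Lemma periodic_powers : exists n l : nat,
  forall y, y \in O -> pO (y ^+ n * (1 - y ^+ l.+1)).
Proof.
have [F [OF resF]] := finite_residues; pose n := size F.
exists n, (n`!).-1 => y Oy; rewrite prednK ?fact_gt0 //.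
have /choice[r rE] i : exists r, r \in F /\ pO (y ^+ i - r).
  by have [r rF pr] := resF _ (OKX i Oy); exists r.
have lt i : (index (r i) F < n)%N by rewrite index_mem; have [] := rE i.
pose f (i : 'I_n.+1) := Ordinal (lt i).
have [i [j [ij rij]]] : exists i j : 'I_n.+1, (i < j)%N /\ r i = r j.
  apply: contrapT => nij.
  suff injf : injective f by have := leq_card f injf; rewrite !card_ord ltnn.
  move=> i j /(congr1 val) /= eij.
  have {}eij : r i = r j.
    have [ri _] := rE i; have [rj _] := rE j.
    by rewrite -(nth_index 0 ri) eij nth_index.
  by case: (ltngtP i j) => [ij|ji|/val_inj //]; case: nij; [exists i, j|exists j, i].
have yij : pO (y ^+ i * (1 - y ^+ (j - i))).
  rewrite mulrBr mulr1 -exprD subnKC; last exact: ltnW.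
  have [_ pi] := rE i; have [_ pj] := rE j.
  by have := OK_dvdB pi pj; rewrite rij opprB addrA subrK.
have le_in : (i <= n)%N by rewrite -ltnS.
have /dvdnP[q ->] : (j - i %| n`!)%N.
  by apply: dvdn_fact; rewrite subn_gt0 ij (leq_trans (leq_subr _ _)) // -ltnS.
have -> : y ^+ n = y ^+ (n - i) * y ^+ i by rewrite -exprD subnK.
rewrite mulnC exprM -[X in X - _](expr1n K q) subrXX.
set S := \sum_(_ < _) _; have OS : S \in O.
  by apply: OK_sum => k _; apply: OKM; [apply/OKX/OK1 | do 2!apply: OKX].
have -> : y ^+ (n - i) * y ^+ i * ((1 - y ^+ (j - i)) * S) =
    (y ^+ (n - i) * S) * (y ^+ i * (1 - y ^+ (j - i))) by ring.
by apply: OK_dvdMl => //; apply: OKM => //; apply: OKX.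
Qed.
End ModuloPrime.
End IntegerRing.

(** * Localizations of the ring of integers *)

Section LocalOK.
Variables (K : fieldExtType rat) (P : K -> Prop) (p : nat).
Local Notation O := (@OK K).
Local Notation pO := (OK_dvd p%:R).
Hypothesis PO : forall x, P x -> x \in O.
Hypothesis PB : forall x y, P x -> P y -> P (x - y).
Hypothesis PM : forall a x, a \in O -> P x -> P (a * x).
Hypothesis P1 : ~ P 1.
Hypothesis P_prime : forall x y, x \in O -> y \in O -> P (x * y) -> P x \/ P y.
Hypothesis p_prime : prime p.
Hypothesis Pp : P p%:R.

Lemma P0 : P 0. Proof. by rewrite -(subrr p%:R); apply: PB. Qed.

Lemma PD x y : P x -> P y -> P (x + y).
Proof.
move=> Px Py; rewrite -[y]opprK -[- y]sub0r.
by do 2!apply: PB => //; apply: P0.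
Qed.

Lemma P_pdvd x : pO x -> P x.
Proof. by move=> [z Oz ->]; rewrite mulrC; apply: PM. Qed.

Lemma nPM x y : x \in O -> y \in O -> ~ P x -> ~ P y -> ~ P (x * y).
Proof. by move=> Ox Oy nPx nPy /(P_prime Ox Oy)[]. Qed.

Lemma nP_int (c : int) : ~~ (p %| c)%Z -> ~ P c%:~R.
Proof.
move=> /prime_inverse-/(_ K p_prime)[u uc] Pc; apply: P1.
have -> : 1 = u%:~R * c%:~R - ((u * c)%:~R - 1) :> K by rewrite rmorphM /=; ring.
by apply: PB; [apply: PM => //; apply: OK_int | apply: P_pdvd].
Qed.

(** Divisibility in the localization of [O] at [P]. *)
Definition ldvd (x y : K) :=
  exists s z, [/\ s \in O, z \in O, ~ P s & s * y = x * z].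

Lemma ldvd_trans x y w : ldvd x y -> ldvd y w -> ldvd x w.
Proof.
move=> [s [z [Os Oz Ps sy]]] [s' [z' [Os' Oz' Ps' sw]]].
exists (s * s'), (z * z'); split; [exact: OKM|exact: OKM|exact: nPM|].
by rewrite -mulrA sw mulrA sy mulrA.
Qed.

Lemma ldvdM x y x' y' : ldvd x y -> ldvd x' y' -> ldvd (x * x') (y * y').
Proof.
move=> [s [z [Os Oz Ps sy]]] [s' [z' [Os' Oz' Ps' sw]]].
exists (s * s'), (z * z'); split; [exact: OKM|exact: OKM|exact: nPM|].
by rewrite mulrACA sy sw mulrACA.
Qed.

Lemma ldvdX x y n : ldvd x y -> ldvd (x ^+ n) (y ^+ n).
Proof.
move=> xy; elim: n => [|n IHn]; last by rewrite !exprS; apply: ldvdM.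
by exists 1, 1; split; rewrite ?OK1 // mulr1.
Qed.

Lemma ldvd_refl x : ldvd x x.
Proof. by exists 1, 1; split; rewrite ?OK1 // mulr1 mul1r. Qed.

Lemma ldvdMr x y : y \in O -> ldvd x (x * y).
Proof. by move=> Oy; exists 1, y; split; rewrite ?OK1 // mul1r. Qed.

Lemma ldvd_cancel a x y : a != 0 -> ldvd (a * x) (a * y) -> ldvd x y.
Proof.
move=> a0 [s [z [Os Oz Ps sy]]]; exists s, z; split=> //.
by apply: (mulfI a0); rewrite mulrCA sy mulrA.
Qed.

Lemma ldvd_nunit x : x \in O -> P x -> ~ ldvd x 1.
Proof.
move=> Ox Px [s [z [Os Oz Ps]]]; rewrite mulr1 => sxz.
by apply: Ps; rewrite sxz mulrC; apply: PM.
Qed.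

(** An element of [K] that satisfies a polynomial equation over [O] with a
    coefficient outside [P] lies in the local ring, or its inverse does: if [a]
    is the leading coefficient then [a * u] is integral, so that one of [a],
    [a * u] is the denominator looked for unless both lie in [P]; in that
    case the degree can be lowered. *)
Lemma local_root u n (c : nat -> K) :
  (forall i, c i \in O) -> \sum_(i < n) c i * u ^+ i = 0 ->
  (exists2 i, (i < n)%N & ~ P (c i)) ->
  exists s, [/\ s \in O, ~ P s & s * u \in O \/ exists2 t, t \in O & s = t * u].
Proof.
elim: n c => [|n IHn] c Oc cu [i ni nPci] //.
have Oau := OK_lead_root Oc cu.
have [Pa|nPa] := pselect (P (c n)); last by exists (c n); split=> //; left.
have [Pau|nPau] := pselect (P (c n * u)); last first.
  by exists (c n * u); split=> //; right; exists (c n).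
case: n => [|n] in IHn cu ni Oau Pa Pau *.
  by case: nPci; move: ni; rewrite ltnS leqn0 => /eqP->.
apply: (IHn (fun i => if i == n then c n + c n.+1 * u else c i)).
- by move=> j; case: ifP => _ //; apply: OKD.
- rewrite -[RHS]cu !big_ord_recr /= eqxx mulrDl addrA exprS mulrA.
  congr (_ + _ + _); apply: eq_bigr => j _.
  by rewrite ltn_eqF.
- move: ni; rewrite ltnS leq_eqVlt => /orP[/eqP ein|ni].
    by case: nPci; rewrite ein.
  exists i => //; case: eqP => // ein Pc; apply: nPci; rewrite ein.
  by rewrite -(addrK (c n.+1 * u) (c n)); apply: PB.
Qed.

(** The localization at [P] is a valuation ring: [x / y] satisfies an equation
    with coprime integer coefficients, and an integer in [P] is divisible by
    [p]. *)
Lemma ldvd_total x y : x \in O -> y \in O -> ldvd x y \/ ldvd y x.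
Proof.
move=> Ox Oy; have [->|y0] := eqVneq y 0.
  by left; exists 1, 0; split; rewrite ?OK1 ?OK0 // mulr0 mulr0.
have [c [cu /(_ p p_prime)[i ni ci]]] :=
  integral_relation (fun i : 'I_(\dim {:K}).+1 => (x / y) ^+ i) (ltnSn _).
have [|s [Os nPs [Osu|[t Ot sE]]]] :=
  local_root (c := fun i => (c i)%:~R) (fun i => OK_int K (c i)) cu.
- by exists i => //; apply: nP_int.
- right; exists s, (s * (x / y)); split=> //.
  by rewrite mulrCA [_ / _]mulrC mulVKf.
- left; exists s, t; split=> //; rewrite sE -mulrA -mulrA mulVf // mulr1.
  exact: mulrC.
Qed.

(** The periodicity of powers modulo [p] says that [y ^ k * (1 - y ^ l)] is
    divisible by [p], and the second factor is a local unit for [y] in [P]. *)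
Lemma ldvd_power : exists k, forall y, P y -> ldvd p%:R (y ^+ k).
Proof.
have [k [l powk]] := periodic_powers K p_prime.
exists k => y Py; have Oy := PO Py; have [z Oz zE] := powk y Oy.
have nP : ~ P (1 - y ^+ l.+1).
  move=> P1y; apply: P1; rewrite -[1](subrK (y ^+ l.+1)); apply: PD => //.
  by rewrite exprSr; apply: PM => //; apply: OKX.
exists (1 - y ^+ l.+1), z; split=> //; last by rewrite mulrC.
by apply: OKB; [apply: OK1 | apply: OKX].
Qed.

(** The exponent [e] with [y ^ e] dividing [p] locally is bounded for [y] in
    [P]; an element of [P] that reaches the largest one generates the maximal
    ideal of the valuation ring, since a proper divisor in [P] would allow a
    square of an element of [P] to divide it. *)
Lemma uniformizer : exists pi e, [/\ P pi, pi != 0, forall y, P y -> ldvd pi y &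
  ldvd p%:R (pi ^+ e) /\ ldvd (pi ^+ e) p%:R].
Proof.
have p0 : p%:R != 0 :> K by apply: natr_neq0; apply: prime_gt0.
have [k powk] := ldvd_power.
pose Q j := `[< exists2 y, P y & ldvd (y ^+ j) p%:R >].
have Q1 : Q 1%N by apply/asboolP; exists p%:R => //; apply: ldvd_refl.
have Qk j : Q j -> (j <= k)%N.
  move=> /asboolP[y Py yj]; rewrite leqNgt; apply/negP=> kj.
  have y0 : y ^+ k != 0.
    apply: expf_neq0; apply/eqP=> y0; move: yj kj; rewrite y0.
    case: j => // j [s [z [_ _ nPs /eqP]]]; rewrite exprS !mul0r mulf_eq0.
    by rewrite (negPf p0) orbF => /eqP s0; case: nPs; rewrite s0; apply: P0.
  have Oy := PO Py; apply: (ldvd_nunit Oy Py); apply: (ldvd_cancel y0).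
  rewrite mulr1 -exprSr; apply: ldvd_trans (powk y Py).
  apply: ldvd_trans yj; rewrite -(subnKC kj) exprD.
  by apply: ldvdMr; apply: OKX.
have exQ : exists j, Q j by exists 1%N.
have [e /asboolP[pi Ppi pie] maxe] := ex_maxnP exQ Qk.
have e0 : (0 < e)%N by apply: maxe.
have piP y : P y -> ldvd pi y.
  move=> Py; have Oy := PO Py; have Opi := PO Ppi.
  have [//|[s [z [Os Oz nPs spi]]]] := ldvd_total Opi Oy.
  have [Pz|nPz] := pselect (P z); last first.
    by exists z, s; split=> //; rewrite mulrC -spi mulrC.
  have half w : P w -> ldvd (w * w) (y * z) -> False.
    move=> Pw wyz; have : Q (e + e)%N.
      apply/asboolP; exists w => //; apply: ldvd_trans pie.
      rewrite exprD -exprMn; apply: ldvdX; apply: ldvd_trans wyz _.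
      by exists s, 1; split=> //; rewrite ?OK1 // mulr1.
    by move/maxe; rewrite leqNgt -addn1 leq_add2l e0.
  by have [yz|zy] := ldvd_total Oy Oz; exfalso;
    [apply: (half y Py) | apply: (half z Pz)]; apply: ldvdM => //; apply: ldvd_refl.
have [s [z [Os Oz nPs spz]]] := pie.
have pi0 : pi != 0.
  apply/eqP=> pi0; apply: nPs; have /eqP := spz.
  rewrite pi0 expr0n gtn_eqF // mul0r mulf_eq0 (negPf p0) orbF => /eqP->.
  exact: P0.
exists pi, e; split=> //; split=> //.
have nPz : ~ P z.
  move=> /piP piz; have : Q e.+1.
    apply/asboolP; exists pi => //; rewrite exprSr.
    apply: ldvd_trans (ldvdM (ldvd_refl _) piz) _.
    by exists s, 1; split=> //; rewrite ?OK1 // mulr1.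
  by move/maxe; rewrite ltnn.
by exists z, s; split=> //; rewrite mulrC -spz mulrC.
Qed.

(** A single denominator serves for all of [P], because [P] is finite modulo
    [p]. *)
Lemma common_denominator pi : (forall y, P y -> ldvd pi y) ->
  exists s, [/\ s \in O, ~ P s & forall y, P y -> OK_dvd pi (s * y)].
Proof.
move=> piP; have [F [OF resF]] := finite_residues K p_prime.
have [t [Ot nPt tF]] : exists t, [/\ t \in O, ~ P t &
    forall r, r \in F -> P r -> OK_dvd pi (t * r)].
  elim: (F) => [|r F' [t [Ot nPt tF]]]; first by exists 1; split; rewrite ?OK1.
  have [/piP[s [z [Os Oz nPs sr]]]|nPr] := pselect (P r); last first.
    exists t; split=> // r'; rewrite inE => /orP[/eqP->|]; last exact: tF.
    by move/nPr.
  exists (s * t); split; [exact: OKM | exact: nPM | move=> r'].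
  rewrite inE => /orP[/eqP-> _|rF Pr].
    by exists (t * z); [apply: OKM | rewrite mulrAC sr; ring].
  by rewrite -mulrA; apply: OK_dvdMl => //; apply: tF.
have [s [z [Os Oz nPs sp]]] := piP _ Pp.
exists (s * t); split; [exact: OKM | exact: nPM | move=> y Py].
have [r rF pyr] := resF y (PO Py); rewrite -[y](subrK r) mulrDr.
apply: OK_dvdD.
  have [w Ow ->] := pyr; exists (t * w * z); first by do 2!apply: OKM => //.
  by rewrite mulrA [s * t * _]mulrAC sp; ring.
rewrite -mulrA; apply: OK_dvdMl => //; apply: tF => //.
by rewrite -[r](subKr y); apply: PB => //; apply: P_pdvd.
Qed.

(** Locally [p] is a unit times [pi ^ e], and an integer prime to [p] is a
    unit. *)
Lemma integer_valuation pi e n : (0 < n)%N ->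
  ldvd p%:R (pi ^+ e) -> ldvd (pi ^+ e) p%:R ->
  exists E, ldvd n%:R (pi ^+ E) /\ ldvd (pi ^+ E) n%:R.
Proof.
move=> n0 ppi pip; have [m pm ->] := pfactor_coprime p_prime n0.
have nPm : ~ P m%:R.
  apply: (@nP_int m); rewrite -prime_coprime // ; exact: pm.
exists (e * logn p n)%N; rewrite natrM natrX exprM mulrC; split.
  rewrite -[X in ldvd _ X]mulr1; apply: ldvdM; first exact: ldvdX.
  by exists m%:R, 1; split; rewrite ?OK1 ?OK_nat.
rewrite -[X in ldvd X _]mulr1; apply: ldvdM; first exact: ldvdX.
by exists 1, m%:R; split; rewrite ?OK1 ?OK_nat // !mul1r.
Qed.
End LocalOK.

(** * Integer-valued polynomials and prime ideals *)

Definition prime_ideal (D : comNzRingType) (M : D -> Prop) :=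
  [/\ forall x y, M x -> M y -> M (x - y), forall a x, M x -> M (a * x),
      ~ M 1 & forall x y, M (x * y) -> M x \/ M y].

(** Zorn's lemma gives an ideal that is maximal among the proper ones that
    contain [I], and such an ideal is prime. *)
Lemma prime_ideal_exists (D : comNzRingType) (I : set D) :
  I 0 -> (forall a x y, I x -> I y -> I (a * x + y)) -> ~ I 1 ->
  exists2 M : D -> Prop, prime_ideal M & forall x, I x -> M x.
Proof.
move=> I0 Ilin I1.
(* The empty set has to qualify, as the union of the empty chain. *)
pose Q (A : set D) := (forall a x y, (A `|` I)%classic x -> (A `|` I)%classic y ->
  (A `|` I)%classic (a * x + y)) /\ ~ (A `|` I)%classic 1.
have [F FQ totF|A [[Alin A1] maxA]] := @Zorn_bigcup D Q.
  split=> [a x y [[X FX Xx]|Ix] [[Y FY Yy]|Iy]|[[X FX X1]|//]].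
  - have [XY|YX] := totF X Y FX FY.
      have [|YI] : (Y `|` I)%classic (a * x + y).
      + by apply: (FQ Y FY).1; [left; apply: XY|left].
      + by move=> ?; left; exists Y.
      + by right.
    have [|XI] : (X `|` I)%classic (a * x + y).
    + by apply: (FQ X FX).1; [left|left; apply: YX].
    + by move=> ?; left; exists X.
    + by right.
  - have [|XI] : (X `|` I)%classic (a * x + y).
    + by apply: (FQ X FX).1; [left|right].
    + by move=> ?; left; exists X.
    + by right.
  - have [|XI] : (Y `|` I)%classic (a * x + y).
    + by apply: (FQ Y FY).1; [right|left].
    + by move=> ?; left; exists Y.
    + by right.
  - by right; apply: Ilin.
  - by apply: (FQ X FX).2; left.
pose M := (A `|` I)%classic.
have M0 : M 0 by right.
have MM a x : M x -> M (a * x).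
  by move=> Mx; rewrite -[a * x]addr0; apply: Alin.
have MB x y : M x -> M y -> M (x - y).
  by move=> Mx My; rewrite addrC -mulN1r; apply: Alin.
exists M; last by right.
split=> // x y Mxy; apply: contrapT => /not_orP[nMx nMy].
have comax z : ~ M z -> exists m r, M m /\ 1 = r * z + m.
  move=> nMz; pose B : set D := [set w | exists m r, M m /\ w = r * z + m]%classic.
  have MBz w : M w -> B w by move=> Mw; exists w, 0; rewrite mul0r add0r.
  have Bz : B z by exists 0, 1; rewrite mul1r addr0.
  have BI w : (B `|` I)%classic w -> B w by case=> // Iw; apply: MBz; right.
  apply: contrapT => nB1; have := maxA B; case.
    split; last by move=> BA; apply: nMz; left; apply: BA.
    by move=> w Aw; apply: MBz; left.
  split; last by move/BI.
  move=> a u v /BI[m [r [Mm ->]]] /BI[m' [r' [Mm' ->]]]; left.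
  exists (a * m + m'), (a * r + r'); split; first exact: Alin.
  by ring.
have [m [r [Mm e1]]] := comax x nMx; have [m' [r' [Mm' e2]]] := comax y nMy.
apply: A1; rewrite -[1]mulr1 {1}e1 e2 -/M.
have -> : (r * x + m) * (r' * y + m') =
    r * r' * (x * y) - (- (r * x + m) * m' - (r' * y) * m) by ring.
exact: (MB _ _ (MM _ _ Mxy) (MB _ _ (MM _ _ Mm') (MM _ _ Mm))).
Qed.

Section IntegerValuedRing.
Variable K : fieldExtType rat.
Local Notation R := (IntOK K).
Local Notation O := (@OK K).

Definition ev (f : R) (x : K) : K := (val f).[x].

Lemma ev_OK f x : x \in O -> ev f x \in O.
Proof. by case: f => f If Ox; have /asboolP := If; apply. Qed.

Lemma evB f g x : ev (f - g) x = ev f x - ev g x.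
Proof. by rewrite /ev raddfB hornerD hornerN. Qed.

Lemma evM f g x : ev (f * g) x = ev f x * ev g x.
Proof. exact: hornerM. Qed.

Lemma ev1 x : ev 1 x = 1.
Proof. exact: hornerC. Qed.

Lemma evX f n x : ev (f ^+ n) x = ev f x ^+ n.
Proof. by elim: n => [|n IHn]; rewrite ?ev1 // !exprS evM IHn. Qed.

(** The constant polynomial [x]; the default value 0 is taken outside [O]. *)
Definition cst (x : K) : R := insubd 0 x%:P.

Lemma val_cst x : x \in O -> val (cst x) = x%:P.
Proof.
move=> Ox; rewrite val_insubd ifT //.
by apply/asboolP => y _; rewrite hornerC.
Qed.

Lemma ev_cst x y : x \in O -> ev (cst x) y = x.
Proof. by move=> Ox; rewrite /ev val_cst // hornerC. Qed.

Lemma cstM x y : x \in O -> y \in O -> cst (x * y) = cst x * cst y.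
Proof.
move=> Ox Oy; apply: val_inj; rewrite rmorphM /= !val_cst ?polyCM //.
exact: OKM.
Qed.

Lemma cstB x y : x \in O -> y \in O -> cst (x - y) = cst x - cst y.
Proof.
move=> Ox Oy; apply: val_inj; rewrite raddfB /= !val_cst ?polyCB //.
exact: OKB.
Qed.

Lemma cst_nat n : cst n%:R = n%:R.
Proof.
by apply: val_inj; rewrite val_cst ?OK_nat // !rmorph_nat.
Qed.

Lemma cst1 : cst 1 = 1. Proof. exact: (cst_nat 1). Qed.

Lemma cstX x n : x \in O -> cst (x ^+ n) = cst x ^+ n.
Proof.
move=> Ox; elim: n => [|n IHn]; first exact: cst1.
by rewrite !exprS cstM ?IHn //; apply: OKX.
Qed.

Lemma IntOK_natr_neq0 n : (0 < n)%N -> n%:R != 0 :> R.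
Proof.
move=> n0; rewrite -(inj_eq val_inj) rmorph_nat rmorph0 -polyC_natr polyC_eq0.
exact: natr_neq0.
Qed.

(** The quotient by [a] of a polynomial whose values are divisible by [a] is
    again integer-valued. *)
Lemma value_division a (f : R) : a != 0 -> a \in O ->
  (forall x, x \in O -> OK_dvd a (ev f x)) -> exists h, f = cst a * h.
Proof.
move=> a0 Oa af.
have Ih : a^-1 *: val f \in @int_valued_pred K.
  apply/asboolP => x Ox; have [z Oz fz] := af x Ox.
  by rewrite hornerZ -/(ev f x) fz mulKf.
exists (exist (fun h => h \in @int_valued_pred K) _ Ih : R); apply: val_inj.
by rewrite rmorphM /= val_cst // mul_polyC scalerA mulfV // scale1r.
Qed.
End IntegerValuedRing.

(** * The ring of integer-valued polynomials is arithmetical *)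

Section LocalIntOK.
Variable K : fieldExtType rat.
Local Notation R := (IntOK K).
Local Notation O := (@OK K).
Variables (M : R -> Prop) (p : nat).
Hypothesis primeM : prime_ideal M.
Hypothesis p_prime : prime p.
Hypothesis Mp : M p%:R.

Let MB x y : M x -> M y -> M (x - y).
Proof. by case: primeM => h _ _ _; apply: h. Qed.
Let MM a x : M x -> M (a * x).
Proof. by case: primeM => _ h _ _; apply: h. Qed.
Let M1 : ~ M 1. Proof. by case: primeM. Qed.
Let M_prime x y : M (x * y) -> M x \/ M y.
Proof. by case: primeM => _ _ _ h; apply: h. Qed.
Let nMM x y : ~ M x -> ~ M y -> ~ M (x * y).
Proof. by move=> nMx nMy /M_prime[]. Qed.

Let P (x : K) : Prop := x \in O /\ M (cst x).

Let PO x : P x -> x \in O. Proof. by case. Qed.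
Let PB x y : P x -> P y -> P (x - y).
Proof.
move=> [Ox Mx] [Oy My]; split; first exact: OKB.
by rewrite cstB //; apply: MB.
Qed.
Let PM a x : a \in O -> P x -> P (a * x).
Proof.
move=> Oa [Ox Mx]; split; first exact: OKM.
by rewrite cstM //; apply: MM.
Qed.
Let P1 : ~ P 1. Proof. by move=> [_]; rewrite cst1. Qed.
Let P_prime x y : x \in O -> y \in O -> P (x * y) -> P x \/ P y.
Proof.
by move=> Ox Oy [_]; rewrite cstM // => /M_prime[]; [left|right].
Qed.
Let Pp : P p%:R. Proof. by split; rewrite ?OK_nat // cst_nat. Qed.
Let nPM x : x \in O -> ~ P x -> ~ M (cst x).
Proof. by move=> Ox nPx Mx; apply: nPx. Qed.

(** Multiplied with the product [L] of its differences with the residues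
    outside [P], an element [f] of [M] takes its values in [P]: at each point
    either [f] itself does or one of the factors of [L] does. As [L] is not in
    [M], a generator of the maximal ideal of the localization of [O] at [P]
    divides [f] locally at [M]. *)
Lemma uniformizer_dvd pi f : P pi -> pi != 0 ->
    (forall y, P y -> ldvd P pi y) -> M f ->
  exists s h, ~ M s /\ s * f = cst pi * h.
Proof.
move=> Ppi pi0 piP Mf.
have [s [Os nPs sP]] := common_denominator PO PB PM P1 P_prime p_prime Pp piP.
have [F [OF resF]] := finite_residues K p_prime.
pose L : R := \prod_(r <- F | `[< ~ P r >]) (f - cst r).
have evL x : ev L x = \prod_(r <- F | `[< ~ P r >]) (ev f x - r).
  rewrite /L; have := OF; elim: (F) => [|r F' IHF] OF'.
    by rewrite !big_nil ev1.
  rewrite !big_cons; have Or : r \in O by apply: OF'; rewrite mem_head.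
  have {}IHF := IHF (fun r' rF => OF' r' (mem_behead (s := r :: F') rF)).
  by case: ifP => _ //; rewrite evM evB ev_cst // IHF.
have nML : ~ M L.
  rewrite /L; have := OF; elim: (F) => [|r F' IHF] OF'.
    by rewrite big_nil.
  rewrite big_cons; have Or : r \in O by apply: OF'; rewrite mem_head.
  have {}IHF := IHF (fun r' rF => OF' r' (mem_behead (s := r :: F') rF)).
  case: ifP => // /asboolP nPr; apply: nMM => // Mfr; apply: nPr; split=> //.
  by rewrite -[cst r](subKr f); apply: MB.
have [x Ox|h hE] := @value_division K pi (cst s * L * f) pi0 (PO Ppi).
  have Ofx := ev_OK f Ox.
  rewrite !evM ev_cst // evL -mulrA; have [r rF pr] := resF _ Ofx.
  have OL (Q : pred K) F' : {subset F' <= F} ->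
      \prod_(r' <- F' | Q r') (ev f x - r') \in O.
    move=> F'F; rewrite big_seq_cond; apply: OK_prod => r' /andP[/F'F r'F _].
    by apply: OKB => //; apply: OF.
  (* Either the value of [f] or the factor for [r] lies in [P]. *)
  have [Pr|nPr] := pselect (P r).
    have Pfx : P (ev f x).
      rewrite -[ev f x](subrK r); apply: (PD PB Pp) => //.
      exact: (P_pdvd PM Pp).
    rewrite mulrCA; apply: OK_dvdMl; last exact: sP.
    by apply: OL.
  rewrite (big_rem _ rF) /=; case: ifP => [_|/asboolP//].
  have -> : s * ((ev f x - r) * \prod_(y <- rem r F | `[< ~ P y >]) (ev f x - y)
       * ev f x) = (\prod_(y <- rem r F | `[< ~ P y >]) (ev f x - y) * ev f x) *
       (s * (ev f x - r)) by ring.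
  apply: OK_dvdMl; last by apply: sP; apply: (P_pdvd PM Pp).
  by apply: OKM => //; apply: OL => y; apply: mem_rem.
exists (cst s * L), h; split=> //; apply: nMM => //; exact: nPM.
Qed.

(** As long as the quotient of [f] by a power of [pi] lies in [M], one more
    factor [pi] can be split off. *)
Lemma local_expansion pi f j : P pi -> pi != 0 ->
    (forall y, P y -> ldvd P pi y) ->
  (exists i s t, [/\ (i < j)%N, ~ M s, ~ M t & s * f = cst pi ^+ i * t]) \/
  (exists s h, ~ M s /\ s * f = cst pi ^+ j * h).
Proof.
move=> Ppi pi0 piP; elim: j => [|j [[i [s [t [ij nMs nMt sf]]]]|[s [h [nMs sf]]]]].
- by right; exists 1, f; rewrite expr0 !mul1r.
- by left; exists i, s, t; split=> //; apply: ltnW.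
have [Mh|nMh] := pselect (M h); last by left; exists j, s, h.
have [s' [h' [nMs' s'h]]] := uniformizer_dvd Ppi pi0 piP Mh.
right; exists (s' * s), h'; split; first exact: nMM.
by rewrite -mulrA sf mulrCA s'h exprSr mulrA.
Qed.

(** Locally at [M] both [f] and [g] are units times powers of [pi] or divisible
    by a power of [pi] that is too high to divide [n]; the latter cannot
    happen to both, so one of them divides the other. *)
Lemma local_comparison (f g u v : R) n : (0 < n)%N -> u * f + v * g = n%:R ->
  exists s h, ~ M s /\ (s * f = g * h \/ s * g = f * h).
Proof.
move=> n0 uv.
have [pi [e [Ppi pi0 piP [ppi pip]]]] := uniformizer PO PB PM P1 P_prime p_prime Pp.
have [E [nE En]] := integer_valuation PB PM P1 P_prime p_prime Pp n0 ppi pip.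
have [s0 [t0 [Os0 Ot0 nPs0 st]]] := nE.
have Opi := PO Ppi.
have stR : cst s0 * cst pi ^+ E = n%:R * cst t0.
  by rewrite -cstX // -cstM ?OKX // st cstM ?OK_nat // cst_nat.
have nMs0 := nPM Os0 nPs0.
have nboth s s' h h' : ~ M s -> ~ M s' -> s * f = cst pi ^+ E.+1 * h ->
    s' * g = cst pi ^+ E.+1 * h' -> False.
  move=> nMs nMs' sf sg.
  have piE0 : cst pi ^+ E != 0.
    rewrite -cstX // -(inj_eq val_inj) val_cst ?OKX // rmorph0 polyC_eq0.
    exact: expf_neq0.
  have : M (s * s' * cst s0).
    have -> : s * s' * cst s0 = (cst t0 * (u * s' * h + v * s * h')) * cst pi.
      apply: (mulfI piE0); rewrite mulrCA [cst pi ^+ E * _]mulrC stR -uv.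
      transitivity (cst t0 * (u * s' * (s * f) + v * s * (s' * g))); first by ring.
      by rewrite sf sg exprSr; ring.
    by apply: MM; case: Ppi.
  by do 2![move=> /M_prime[]//].
have comp a b i j s t s' h : ~ M s -> ~ M t -> ~ M s' -> (i <= j)%N ->
    s * a = cst pi ^+ i * t -> s' * b = cst pi ^+ j * h ->
    exists s h, ~ M s /\ s * b = a * h.
  move=> nMs nMt nMs' ij sa sb; exists (t * s'), (s * (cst pi ^+ (j - i) * h)).
  split; first exact: nMM.
  by rewrite -mulrA sb -(subnKC ij) exprD mulrA [a * _]mulrA [a * s]mulrC sa
    addKn; ring.
have [[i [s [t [iE nMs nMt sf]]]]|[s [h [nMs sf]]]] :=
    local_expansion f E.+1 Ppi pi0 piP;
  have [[j [s' [t' [jE nMs' nMt' sg]]]]|[s' [h' [nMs' sg]]]] :=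
    local_expansion g E.+1 Ppi pi0 piP.
- have [ij|ji] := leqP i j.
    have [r [k [nMr rk]]] := comp _ _ _ _ _ _ _ _ nMs nMt nMs' ij sf sg.
    by exists r, k; split=> //; right.
  have [r [k [nMr rk]]] := comp _ _ _ _ _ _ _ _ nMs' nMt' nMs (ltnW ji) sg sf.
  by exists r, k; split=> //; left.
- have [r [k [nMr rk]]] := comp _ _ _ _ _ _ _ _ nMs nMt nMs' (ltnW iE) sf sg.
  by exists r, k; split=> //; right.
- have [r [k [nMr rk]]] := comp _ _ _ _ _ _ _ _ nMs' nMt' nMs (ltnW jE) sg sf.
  by exists r, k; split=> //; left.
- by have := nboth _ _ _ _ nMs nMs' sf sg.
Qed.
End LocalIntOK.

Section Arithmetical.
Variable K : fieldExtType rat.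
Local Notation R := (IntOK K).
Local Notation O := (@OK K).

Lemma prime_ideal_nat (M : R -> Prop) n : prime_ideal M -> (0 < n)%N ->
  M n%:R -> exists2 p, prime p & M p%:R.
Proof.
case=> _ MM M1 M_prime.
elim/ltn_ind: n => n IHn n0 Mn; have [n1|n1] := leqP n 1.
  have e1 : n = 1%N by apply/eqP; rewrite eqn_leq n1 n0.
  by case: M1; rewrite e1 in Mn.
have := Mn; rewrite -(divnK (pdiv_dvd n)) natrM => /M_prime[Md|Mp].
  apply: IHn Md; last by rewrite divn_gt0 ?pdiv_gt0 // pdiv_leq.
  by rewrite ltn_Pdiv // prime_gt1 // pdiv_prime.
by exists (pdiv n) => //; apply: pdiv_prime.
Qed.

(** The multipliers [b1] with [b1 * g] in the ideal of [f] and [b2] with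
    [b2 * f] in that of [g] generate an ideal; a prime ideal that contains it
    contains [f] and [g], hence [n], and the comparison of [f] and [g] locally
    at this prime ideal gives a multiplier outside it. *)
Lemma arithmetical_bezout (f g u v : R) n : (0 < n)%N ->
  u * f + v * g = n%:R -> exists b c e, b * g = c * f /\ (1 - b) * f = e * g.
Proof.
move=> n0 uv.
pose I : set R := [set x | exists b1 b2 c1 c2, [/\ x = b1 + b2,
  b1 * g = c1 * f & b2 * f = c2 * g]]%classic.
have [[b1 [b2 [c1 [c2 [b12 bg bf]]]]]|nI1] := pselect (I 1).
  by exists b1, c1, c2; split=> //; rewrite b12 addrC addKr.
have [||M primeM IM] := prime_ideal_exists _ _ nI1.
- by exists 0, 0, 0, 0; rewrite add0r !mul0r.
- move=> a _ _ [b1 [b2 [c1 [c2 [-> bg bf]]]]] [b1' [b2' [c1' [c2' [-> bg' bf']]]]].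
  exists (a * b1 + b1'), (a * b2 + b2'), (a * c1 + c1'), (a * c2 + c2').
  by split; [ring | rewrite !mulrDl -!mulrA bg bg' | rewrite !mulrDl -!mulrA bf bf'].
have I1 s h : s * g = h * f -> M s.
  by move=> sg; apply: IM; exists s, 0, h, 0; rewrite addr0 !mul0r.
have I2 s h : s * f = h * g -> M s.
  by move=> sg; apply: IM; exists 0, s, 0, h; rewrite add0r !mul0r.
have Mn : M n%:R.
  have Mf : M f by apply: (I1 _ g); apply: mulrC.
  have Mg : M g by apply: (I2 _ f); apply: mulrC.
  case: (primeM) => MB MM _ _; rewrite -uv -[v * g]opprK -mulNr.
  by apply: (MB _ _ (MM _ _ Mf) (MM _ _ Mg)).
have [p p_prime Mp] := prime_ideal_nat primeM n0 Mn.
have [s [h [nMs [sf|sg]]]] := local_comparison primeM p_prime Mp n0 uv.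
  by case: nMs; apply: (I2 s h); rewrite sf mulrC.
by case: nMs; apply: (I1 s h); rewrite sg mulrC.
Qed.

Lemma clear_denominators (q : {poly K}) :
  exists2 n, (0 < n)%N & n%:R *: q \in @int_valued_pred K.
Proof.
have [n n0 nq] : exists2 n, (0 < n)%N & forall i, n%:R * q`_i \in O.
  suff [n n0 nq] : exists2 n, (0 < n)%N &
      forall i, (i < size q)%N -> n%:R * q`_i \in O.
    exists n => // i; have [/nq//|qi] := ltnP i (size q).
    by rewrite nth_default // mulr0 OK0.
  elim: (size q) => [|k [n n0 nq]]; first by exists 1%N.
  have [m m0 mq] := OK_denominator q`_k.
  exists (n * m)%N => [|i]; first by rewrite muln_gt0 n0.
  rewrite ltnS leq_eqVlt natrM => /orP[/eqP->|/nq Oi].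
    by rewrite -mulrA; apply: OKM => //; apply: OK_nat.
  by rewrite mulrAC mulrC; apply: OKM => //; apply: OK_nat.
exists n => //; apply/asboolP => x Ox; rewrite horner_coef.
by apply: OK_sum => i _; rewrite coefZ; apply: OKM; [apply: nq | apply: OKX].
Qed.

Lemma common_multiple (I : finType) (q : I -> {poly K}) :
  exists2 n, (0 < n)%N & exists f : I -> R, forall i, val (f i) = n%:R *: q i.
Proof.
have /choice[m mP] i : exists m, (0 < m)%N /\ m%:R *: q i \in @int_valued_pred K.
  by have [m] := clear_denominators (q i); exists m.
pose n := (\prod_i m i)%N; exists n.
  by rewrite prodn_gt0 // => i; have [] := mP i.
suff /choice[f fE] i : exists f : R, val f = n%:R *: q i by exists f.
have [_ Im] := mP i; rewrite /n (bigD1 i) //= mulnC natrM -scalerA.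
pose g : R := exist (fun h => h \in @int_valued_pred K) _ Im.
exists ((\prod_(j | j != i) m j)%:R * g).
rewrite -[sval _]/(val ((\prod_(j | j != i) m j)%:R * g)).
by rewrite rmorphM rmorph_nat mulr_natl scaler_nat.
Qed.

(** The condition on [f] and [g] is homogeneous, so [f] and [g] may be divided
    by their greatest common divisor in [K[X]] and multiplied by a common
    denominator, which reduces it to the case of a Bezout relation. *)
Theorem IntOK_arithmetical : arithmetical R.
Proof.
move=> f g.
have [->|f0] := eqVneq f 0; first by exists 0, 0, 0; rewrite !mul0r mulr0.
pose h := gcdp (val f) (val g).
have vf0 : val f != 0.
  by apply: contraNneq f0 => vf0; apply/eqP/val_inj; rewrite vf0 rmorph0.
pose f1 := val f %/ h; pose g1 := val g %/ h.
have fE : val f = f1 * h by rewrite divpK // dvdp_gcdl.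
have gE : val g = g1 * h by rewrite divpK // dvdp_gcdr.
have /Bezout_eq1_coprimepP[[u v] /= uv] : coprimep f1 g1.
  by apply: coprimep_div_gcd; rewrite vf0.
have [n n0 [F FE]] := common_multiple (fun i : bool * bool =>
  if i.1 then if i.2 then f1 else g1 else if i.2 then u else v).
have nn0 : (0 < n * n)%N by rewrite muln_gt0 n0.
have := FE (true, true); have := FE (true, false).
have := FE (false, true); have := FE (false, false).
set f' := F (true, true); set g' := F (true, false).
set u' := F (false, true); set v' := F (false, false).
move=> /= v'E u'E g'E f'E.
have nz : n%:R != 0 :> K by apply: natr_neq0.
have [|b [c [e [bg bf]]]] := @arithmetical_bezout f' g' u' v' _ nn0.
  apply: val_inj; rewrite rmorph_nat rmorphD !rmorphM /= v'E u'E g'E f'E.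
  rewrite -!scalerAl -!scalerAr -!scalerDr uv scalerA.
  by rewrite -mul_polyC mulr1 polyCM !rmorph_nat.
exists b, c, e; split; apply: val_inj; apply: (scalerI nz).
  have := congr1 (fun x : R => val x * h) bg.
  rewrite !rmorphM /= f'E g'E fE gE.
  by rewrite -!scalerAr -!scalerAl -!mulrA.
have := congr1 (fun x : R => val x * h) bf.
rewrite !rmorphM /= f'E g'E fE gE.
by rewrite -!scalerAr -!scalerAl -!mulrA.
Qed.
End Arithmetical.

(** * Values of the bilinear form of a matrix *)

Section BilinearForm.
Variables (D : comNzRingType) (m s : nat) (B : 'M[D]_(m, s)).

Definition mxform (x : 'rV_m) (y : 'cV_s) : D := (x *m B *m y) 0 0.

Lemma mxform_linl a x x' y :
  mxform (x + a *: x') y = mxform x y + a * mxform x' y.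
Proof. by rewrite /mxform !mulmxDl -!scalemxAl !mxE. Qed.

Lemma mxform_linr a x y y' :
  mxform x (y + a *: y') = mxform x y + a * mxform x y'.
Proof. by rewrite /mxform mulmxDr -!scalemxAr !mxE. Qed.

Lemma mxformZl a x y : mxform (a *: x) y = a * mxform x y.
Proof. by rewrite /mxform -!scalemxAl !mxE. Qed.

Lemma mxformZr a x y : mxform x (a *: y) = a * mxform x y.
Proof. by rewrite /mxform -!scalemxAr !mxE. Qed.

Lemma mxform_combination a b c d x x' y y' :
  mxform (a *: x + b *: x') (c *: y + d *: y') =
  a * c * mxform x y + a * d * mxform x y' + b * c * mxform x' y
    + b * d * mxform x' y'.
Proof.
rewrite /mxform !mulmxDl !mulmxDr -!scalemxAl -!scalemxAr !mxE; ring.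
Qed.

Lemma mxform_delta i j : mxform (delta_mx 0 i) (delta_mx j 0) = B i j.
Proof. by rewrite /mxform -rowE -colE !mxE. Qed.

(** The determinant of the 2x2 matrix of values of the form on [x], [y] and
    [v], [w]. *)
Definition mxform_det x v y w :=
  mxform x v * mxform y w - mxform x w * mxform y v.

Lemma mxform_det_linl x v y y' w a :
  mxform_det x v (y + a *: y') w =
  mxform_det x v y w + a * mxform_det x v y' w.
Proof. by rewrite /mxform_det !mxform_linl; ring. Qed.

Lemma mxform_det_linr x v y w w' a :
  mxform_det x v y (w + a *: w') =
  mxform_det x v y w + a * mxform_det x v y w'.
Proof. by rewrite /mxform_det !mxform_linr; ring. Qed.

Lemma mxform0 y : mxform 0 y = 0.
Proof. by rewrite /mxform !mul0mx mxE. Qed.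

End BilinearForm.

(** The hypothesis says that the product of the column [B * v] and the row
    [x * B] is the multiple of [B] by the value of the form on [x] and [v]. *)
Lemma mxform_det0_rank1 (D : idomainType) m s (B : 'M[D]_(m, s)) x v :
  mxform B x v != 0 -> (forall y w, mxform_det B x v y w = 0) -> rank1_mx B.
Proof.
set a := mxform B x v => a0 det0 i k j l.
have aB i' j' : a * B i' j' =
    mxform B x (delta_mx j' 0) * mxform B (delta_mx 0 i') v.
  have /eqP := det0 (delta_mx 0 i') (delta_mx j' 0).
  by rewrite /mxform_det subr_eq0 => /eqP <-; rewrite mxform_delta.
apply: (mulfI a0); apply: (mulfI a0).
transitivity ((a * B i j) * (a * B k l)); first by ring.
by transitivity ((a * B i l) * (a * B k j)); [rewrite !aB|]; ring.
Qed.

(** A value of least degree [g = x * B * y], nonzero, has the required property,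
    as in the reduction to Smith normal form: the remainders modulo [g] of the
    values on [x'], [y] and [x], [y'] are values too, hence zero; and [x] may
    be replaced by any other vector that has value [g] with [y]. *)
Lemma minimal_value (F : fieldType) m s (B : 'M[{poly F}]_(m, s)) : B != 0 ->
  exists x y, mxform B x y != 0 /\ forall i j, mxform B x y %| B i j.
Proof.
move=> B0; pose Q d := `[< exists x y,
  mxform B x y != 0 /\ (size (mxform B x y) <= d)%N >].
have exQ : exists d, Q d.
  have [i [j Bij]] : exists i j, B i j != 0.
    apply: contrapT => nB; case/eqP: B0; apply/matrixP=> i j.
    rewrite mxE; apply/eqP/negP=> /negP Bij; apply: nB; by exists i, j.
  exists (size (B i j)); apply/asboolP; exists (delta_mx 0 i), (delta_mx j 0).
  by rewrite mxform_delta.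
have [d /asboolP[x [y [g0 gd]]] mind] := ex_minnP exQ.
have minQ x' y' : (size (mxform B x' y') < size (mxform B x y))%N ->
    mxform B x' y' = 0.
  move=> lt; apply/eqP/negP=> /negP nz.
  have /mind : Q (size (mxform B x' y')) by apply/asboolP; exists x', y'.
  by rewrite leqNgt (leq_trans lt gd).
set g := mxform B x y in g0 gd minQ *.
have divl x' y' : mxform B x' y' = g -> forall x2, g %| mxform B x2 y'.
  move=> xy x2; rewrite -[_ %| _]/(_ == 0); apply/eqP.
  have /minQ : (size (mxform B (x2 + (- (mxform B x2 y' %/ g)) *: x') y') < size g)%N.
    rewrite mxform_linl xy {1}(divp_eq (mxform B x2 y') g) mulNr addrAC subrr add0r.
    exact: ltn_modpN0.
  by rewrite mxform_linl xy {1}(divp_eq (mxform B x2 y') g) mulNr addrAC subrr add0r.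
have divr x' y' : mxform B x' y' = g -> forall y2, g %| mxform B x' y2.
  move=> xy y2; rewrite -[_ %| _]/(_ == 0); apply/eqP.
  have /minQ : (size (mxform B x' (y2 + (- (mxform B x' y2 %/ g)) *: y')) < size g)%N.
    rewrite mxform_linr xy {1}(divp_eq (mxform B x' y2) g) mulNr addrAC subrr add0r.
    exact: ltn_modpN0.
  by rewrite mxform_linr xy {1}(divp_eq (mxform B x' y2) g) mulNr addrAC subrr add0r.
exists x, y; split=> // i j; rewrite -mxform_delta.
set x2 := delta_mx 0 i; set y2 := delta_mx j 0.
have /dvdpP[q qE] := divl x y (erefl _) x2.
have /dvdpP[r rE] := divr x y (erefl _) y2.
(* This vector is [x2] made orthogonal to [y], plus [x]. *)
have gE : mxform B (x2 + (1 - q) *: x) y = g.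
  by rewrite mxform_linl qE -/g; ring.
have := divr _ _ gE y2; rewrite mxform_linl rE => gdiv.
have -> : mxform B x2 y2 = mxform B x2 y2 + (1 - q) * (r * g) - (1 - q) * r * g.
  by ring.
by rewrite dvdp_sub // dvdp_mull.
Qed.

Section ZeroDimensional.
Variables (D : comNzRingType) (nu : D).

Definition dvdr (x : D) := exists h, x = nu * h.

Lemma dvdrD x y : dvdr x -> dvdr y -> dvdr (x + y).
Proof. by move=> [h ->] [k ->]; exists (h + k); rewrite mulrDr. Qed.

Lemma dvdrMl a x : dvdr x -> dvdr (a * x).
Proof. by move=> [h ->]; exists (a * h); rewrite mulrCA. Qed.

(** Nilpotency modulo [nu]. *)
Definition nilr x := exists k, dvdr (x ^+ k).

Lemma nilrM a x : nilr x -> nilr (a * x).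
Proof. by move=> [k xk]; exists k; rewrite exprMn; apply: dvdrMl. Qed.

Lemma nilrD x y : nilr x -> nilr y -> nilr (x + y).
Proof.
move=> [k xk] [l yl]; exists (k + l)%N; rewrite exprDn.
apply: big_ind => [||i _]; [by exists 0; rewrite mulr0 | exact: dvdrD |].
rewrite -mulr_natl; apply: dvdrMl.
have [li|il] := leqP l i.
  have -> : y ^+ i = y ^+ (i - l) * y ^+ l by rewrite -exprD subnK.
  by rewrite mulrA; apply: dvdrMl.
have ki : (k <= k + l - i)%N by rewrite -addnBA ?leq_addr // ltnW.
have -> : x ^+ (k + l - i) = x ^+ (k + l - i - k) * x ^+ k.
  by rewrite -exprD subnK.
by rewrite mulrAC; apply: dvdrMl.
Qed.

Lemma nilr_sum (I : Type) (r : seq I) (F : I -> D) :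
  (forall i, nilr (F i)) -> nilr (\sum_(i <- r) F i).
Proof.
move=> nF; apply: big_ind => [||//]; [exists 1%N, 0 | exact: nilrD].
by rewrite mulr0.
Qed.

(** Modulo [nu] the ring has dimension zero: a power of each element generates
    an idempotent ideal. *)
Hypothesis zero_dim : forall x : D, exists k g, dvdr (x ^+ k * (1 - g * x)).

Lemma power_idempotent x : exists k g, let e := g * x in
  dvdr (e * (1 - e)) /\ dvdr (x ^+ k * (1 - e)).
Proof.
have [k [g xk]] := zero_dim x.
have xk1 : dvdr (x ^+ k * (1 - (g * x) ^+ k.+1)).
  rewrite -opprB subrX1 -mulNr opprB mulrA mulrC; exact: dvdrMl.
exists k, (g ^+ k.+1 * x ^+ k) => /=.
have -> : g ^+ k.+1 * x ^+ k * x = (g * x) ^+ k.+1.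
  by rewrite exprMn [x ^+ k.+1]exprSr mulrA.
split=> //; rewrite {1}exprMn [x ^+ k.+1]exprS -!mulrA.
by do 2!apply: dvdrMl.
Qed.

(** The values of the bilinear form of [B] that are idempotent modulo [nu] are
    closed under joins [e + f - e * f], so one of them divides a power of each
    entry; if the entries generate the unit ideal it is 1. *)
Lemma unimodular_value m s (B : 'M[D]_(m, s)) (Y : 'M_(s, m)) :
  \tr (B *m Y) = 1 -> exists x y, dvdr (mxform B x y - 1).
Proof.
move=> trY.
have [x [y [idem pow]]] : exists x y, let e := mxform B x y in
    dvdr (e * (1 - e)) /\ forall ij : 'I_m * 'I_s,
      exists k, dvdr (B ij.1 ij.2 ^+ k * (1 - e)).
  suff [x [y [idem pow]]] : exists x y, let e := mxform B x y in
      dvdr (e * (1 - e)) /\ forall ij, ij \in enum {: 'I_m * 'I_s} ->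
      exists k, dvdr (B ij.1 ij.2 ^+ k * (1 - e)).
    by exists x, y; split=> // ij; apply: pow; rewrite mem_enum.
  elim: (enum _) => [|[i j] l [x1 [y1 /= [idem pow]]]].
    exists 0, 0; rewrite /= mxform0 mul0r; split=> //.
    by exists 0; rewrite mulr0.
  have [k [g /= [idem2 pow2]]] := power_idempotent (B i j).
  set e1 := mxform B x1 y1 in idem pow; set e2 := g * B i j in idem2 pow2.
  pose x2 : 'rV[D]_m := g *: delta_mx 0 i; pose y2 : 'cV[D]_s := delta_mx j 0.
  have e2E : mxform B x2 y2 = e2 by rewrite mxformZl mxform_delta.
  exists (e1 *: x1 + (1 - e1) *: x2), (e1 *: y1 + (1 - e1) *: y2).
  set e := mxform B _ _; have [q eE] : exists q,
      1 - e = (1 - e1) * (1 - e2) + q * (e1 * (1 - e1)).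
    exists (1 + e1 + e2 - mxform B x1 y2 - mxform B x2 y1).
    by rewrite /e mxform_combination -/e1 e2E; ring.
  split=> /= [|ij].
    have -> : e * (1 - e) = (1 - (1 - e)) * (1 - e) by ring.
    rewrite eE; set t := (1 - e1) * (1 - e2).
    have -> : (1 - (t + q * (e1 * (1 - e1)))) * (t + q * (e1 * (1 - e1))) =
        (1 - e2 + q * (1 - t *+ 2 - q * (e1 * (1 - e1)))) * (e1 * (1 - e1)) +
        (1 - e1) ^+ 2 * (e2 * (1 - e2)) by rewrite /t; ring.
    by apply: dvdrD; apply: dvdrMl.
  rewrite inE eE => ijl; suff [k' pk'] : exists k',
      dvdr (B ij.1 ij.2 ^+ k' * ((1 - e1) * (1 - e2))).
    by exists k'; rewrite mulrDr; apply: dvdrD => //; do 2!apply: dvdrMl.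
  case/orP: ijl => [/eqP-> /=|/pow[k' pk']].
    by exists k; rewrite mulrCA; apply: dvdrMl.
  by exists k'; rewrite mulrA mulrC; apply: dvdrMl.
set e := mxform B x y in idem pow.
have [K nK] : nilr (1 - e).
  have -> : 1 - e = \sum_i \sum_j Y j i * (B i j * (1 - e)).
    rewrite -[LHS]mul1r -{1}trY /mxtrace mulr_suml; apply: eq_bigr => i _.
    by rewrite mxE mulr_suml; apply: eq_bigr => j _; ring.
  apply: nilr_sum => i; apply: nilr_sum => j; apply: nilrM.
  have [k pk] := pow (i, j); exists k.+1.
  rewrite exprMn [(1 - e) ^+ _]exprSr exprS.
  have -> : B i j * B i j ^+ k * ((1 - e) ^+ k * (1 - e)) =
    (B i j * (1 - e) ^+ k) * (B i j ^+ k * (1 - e)) by ring.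
  exact: dvdrMl.
exists ((\sum_(i < K) (1 - e) ^+ i) *: x), y.
rewrite mxformZl -/e.
have -> : (\sum_(i < K) (1 - e) ^+ i) * e - 1 = - 1 * (1 - e) ^+ K.
  have := subrX1 (1 - e) K; set S := \sum_(i < K) _ => h.
  have -> : S * e = - ((1 - e - 1) * S) by ring.
  by rewrite -h; ring.
exact: dvdrMl.
Qed.
End ZeroDimensional.

(** * The criterion implies stacked bases *)

Section Criterion.
Variable K : fieldExtType rat.
Local Notation R := (IntOK K).
Local Notation O := (@OK K).

(** For a prime number [p] this is the periodicity of powers in the finite ring
    [O / p], applied to all values at once. *)
Lemma zero_dim_nat n : (0 < n)%N ->
  forall f : R, exists k g, dvdr n%:R (f ^+ k * (1 - g * f)).
Proof.
elim/ltn_ind: n => n IHn n0 f; have [n1|n1] := leqP n 1.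
  have -> : n = 1%N by apply/eqP; rewrite eqn_leq n1 n0.
  by exists 0%N, 0, 1; rewrite mul0r subr0 expr0 !mulr1.
have p_prime := pdiv_prime n1; set p := pdiv n in p_prime.
have [||k [g [h fk]]] := IHn (n %/ p)%N _ _ f.
- by rewrite ltn_Pdiv // prime_gt1.
- by rewrite divn_gt0 ?pdiv_gt0 // pdiv_leq.
have [k' [l powl]] := periodic_powers K p_prime.
have [|||h' h'E] := @value_division K p%:R (f ^+ k' * (1 - f ^+ l.+1)).
- by apply: natr_neq0; apply: prime_gt0.
- exact: OK_nat.
- by move=> x Ox; rewrite evM evB ev1 !evX; apply: powl; apply: ev_OK.
exists (k + k')%N, (g + f ^+ l - g * f ^+ l * f), (h * h').
have -> : n%:R = (n %/ p)%:R * p%:R :> R by rewrite -natrM divnK // pdiv_dvd.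
transitivity ((f ^+ k * (1 - g * f)) * (f ^+ k' * (1 - f ^+ l.+1))).
  by rewrite exprD exprS; ring.
by rewrite fk h'E cst_nat; ring.
Qed.

(** Over [K[X]] a least value of the form divides the content of [B], so it is a
    nonzero constant and can be normalized to 1; denominators are cleared
    afterwards. *)
Lemma constant_value m s (B : 'M[R]_(m, s)) (Y : 'M_(s, m)) :
  \tr (B *m Y) = 1 ->
  exists x y, exists2 n, (0 < n)%N & mxform B x y = n%:R.
Proof.
move=> trY; pose Bp := map_mx val B.
have trYp : \tr (Bp *m map_mx val Y) = 1 by rewrite -map_mxM trace_map_mx trY rmorph1.
have Bp0 : Bp != 0.
  apply/eqP=> Bp0; have /eqP := trYp.
  by rewrite Bp0 mul0mx mxtrace0 eq_sym oner_eq0.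
have [x [y [g0 gB]]] := minimal_value Bp0; set g := mxform _ _ _ in g0 gB.
have g1 : g %| 1.
  rewrite -trYp; apply: (big_ind (fun q => g %| q)) => [|p q gp gq|i _].
  - exact: dvdp0.
  - exact: dvdp_add.
  rewrite mxE; apply: (big_ind (fun q => g %| q)) => [|p q gp gq|j _].
  - exact: dvdp0.
  - exact: dvdp_add.
  by apply: dvdp_mulr; rewrite gB.
have [c c0 gE] : exists2 c, c != 0 & g = c%:P.
  have := g1; rewrite dvdp1 => /size_poly1P[c c0 gE]; by exists c.
pose x' := c^-1%:P *: x.
have xy1 : mxform Bp x' y = 1.
  by rewrite mxformZl -/g gE -polyCM mulVf.
have [n n0 [F FE]] := common_multiple (x' 0).
have [n' n'0 [G GE]] := common_multiple (fun j => y j 0).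
exists (\row_i F i), (\col_j G j), (n * n')%N; first by rewrite muln_gt0 n0.
apply: val_inj; rewrite rmorph_nat.
have -> : val (mxform B (\row_i F i) (\col_j G j)) =
   mxform Bp (map_mx val (\row_i F i)) (map_mx val (\col_j G j)).
  by rewrite /mxform /Bp -2!map_mxM [RHS]mxE.
have -> : map_mx val (\row_i F i) = n%:R%:P *: x'.
  by apply/matrixP=> i j; rewrite ord1 !mxE FE -mul_polyC mxE.
have -> : map_mx val (\col_j G j) = n'%:R%:P *: y.
  by apply/matrixP=> i j; rewrite ord1 !mxE GE mul_polyC.
by rewrite mxformZl mxformZr xy1 mulr1 !rmorph_nat natrM.
Qed.

(** Multiplied by [2 ^ n], a monic equation of degree [n] for one half becomes a
    relation between integers of which all terms but one are even. *)
Lemma half_not_integral (x : K) : x \in O -> 2%:R * x <> 1.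
Proof.
move=> /OKP[q mq qx] x2.
have x0 : x != 0.
  by apply/eqP=> x0; move/eqP: x2; rewrite x0 mulr0 eq_sym oner_eq0.
have sq : (0 < size q)%N.
  by rewrite size_poly_gt0 monic_neq0.
pose n := (size q).-1; have nE : size q = n.+1 by rewrite prednK.
pose z : int := \sum_(i < n) q`_i * 2 ^+ (n - i).-1.
have z1 : (z * 2 + 1)%:~R = 0 :> K.
  rewrite -(mulr0 (2%:R ^+ n)); move/rootP: qx => <-.
  rewrite horner_coef size_map_inj_poly //; last exact: intr_K_inj.
  rewrite nE big_ord_recr /= [RHS]mulrDr coef_map /=.
  have -> : q`_n = 1 by move/eqP: mq; rewrite lead_coefE.
  rewrite rmorph1 mul1r -exprMn x2 expr1n rmorphD rmorphM rmorph_sum /=.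
  rewrite mulr_suml mulr_sumr.
  congr (_ + _); apply: eq_bigr => i _; rewrite coef_map /=.
  have -> : 2%:R ^+ n = 2%:R ^+ (n - i).-1 * 2%:R * 2%:R ^+ i :> K.
    rewrite -exprSr prednK ?subn_gt0 // -exprD subnK //; exact: ltnW.
  transitivity ((q`_i)%:~R * (2%:R ^+ (n - i).-1) * 2%:R * (2%:R * x) ^+ i); last first.
    by rewrite exprMn; ring.
  by rewrite x2 expr1n mulr1 rmorphM rmorphXn.
have z0 : z * 2 + 1 = 0 by apply: (@intr_K_inj K).
have : (2 %| 1)%Z.
  apply/dvdzP; exists (- z); rewrite mulNr; apply/eqP.
  by rewrite -subr_eq0 opprK addrC z0.
by [].
Qed.

End Criterion.

Section Splitting22.
Variable K : fieldExtType rat.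
Local Notation R := (IntOK K).
Local Notation O := (@OK K).

Lemma constOK_nat n : constOK (n%:R : R).
Proof. by exists n%:R; rewrite ?OK_nat // !rmorph_nat. Qed.

(** The values [2 * n] serve as the nonunit constants [a] of the restricted
    criterion. *)
Lemma double_not_unit n : ~ unitsOK ((2 * n)%:R : R).
Proof.
move=> [_ [g [x Ox gx] /(congr1 val)]].
rewrite rmorphM rmorph1 rmorph_nat /= gx -polyC_natr -polyCM natrM -mulrA.
move=> /polyC_inj; apply: half_not_integral; apply: OKM => //; exact: OK_nat.
Qed.

(** The values of [c0 + l * c1] for [l] a power of [X] are eventually of
    positive degree. *)
Lemma nonconstant_perturbation (c0 c1 : R) : c1 != 0 ->
  exists l : R, ~ constOK (c0 + l * c1).
Proof.
move=> c1n0; have vc1 : val c1 != 0.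
  by apply: contraNneq c1n0 => vc; apply/eqP/val_inj; rewrite vc rmorph0.
have IX : 'X \in @int_valued_pred K.
  by apply/asboolP => x Ox; rewrite hornerX.
pose Xi : R := exist (fun h => h \in @int_valued_pred K) _ IX.
pose k := (size (val c0)).+1; exists (Xi ^+ k) => -[x _].
rewrite rmorphD rmorphM rmorphXn /= => e.
have sz : size ('X^k * val c1) = (k + size (val c1))%N.
  by rewrite mulrC size_mulXn.
have c1pos : (0 < size (val c1))%N by rewrite size_poly_gt0.
have := congr1 (fun q : {poly K} => size q) e; rewrite addrC size_polyDl sz.
  move=> sx; have := size_polyC_leq1 x; rewrite -sx leqNgt /k.
  by rewrite (leq_trans (n := (size (val c0)).+1 + 1)) ?leq_add2l // addn1 ltnS.
by rewrite /k addSn ltnS leq_addr.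
Qed.

Hypothesis crit : forall a b c d : R,
  constOK a -> a <> 0 -> ~ unitsOK a ->
  ideal_gen [set a; c; d] = [set: R] ->
  ~ constOK (\det (mx22 a c b d)) ->
  exists C : 'M[R]_2, cont (mx22 a c b d *m C) = [set: R] /\
    \det (mx22 a c b d *m C) = 0.

(** [U * B * V] is the 2x2 matrix of values of the form, to which the criterion
    is applied; its determinant is nonzero, so [C] has rank one, and the
    product [U * (B * V * C)] can only have unit content if [B * V * C] has. *)
Lemma splitting_of_criterion : rank1_splitting R.
Proof.
move=> m s B Y trY; pose f := mxform B.
have [x0 [v [n n0 fn]]] := constant_value trY.
have n2 : (0 < 2 * n)%N by rewrite muln_gt0.
have [x fx] : exists x, f x v = (2 * n)%:R.
  by exists (2%:R *: x0); rewrite /f mxformZl fn -natrM.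
have [a aE] : exists a : R, a = (2 * n)%:R by exists (2 * n)%:R.
have fa : f x v = a by rewrite aE.
have a0 : a != 0 by rewrite aE; apply: IntOK_natr_neq0.
pose delta := mxform_det B x v.
have [rk1|/existsNP[t /existsNP[t' /eqP dtt]]] :=
    pselect (forall y w, delta y w = 0).
  exists Y => //; apply: rank1_mulmxr.
  by apply: (mxform_det0_rank1 (x := x) (v := v)); rewrite // -/(f x v) fa.
have [y [w [h fyw]]] := unimodular_value (@zero_dim_nat K _ n2) trY.
rewrite -aE in fyw.
(* Multiples of [a] are added to [w] and [y] to make the determinant
   nonconstant; this does not change [f y w] modulo [a]. *)
have [mu dw] : exists mu, delta t (w + (a * mu) *: t') != 0.
  have [d0|d0] := eqVneq (delta t w) 0; last first.
    by exists 0; rewrite mulr0 scale0r addr0.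
  by exists 1; rewrite mulr1 /delta mxform_det_linr -/delta d0 add0r mulf_neq0.
set w' := w + _ in dw.
have [l nonc] := nonconstant_perturbation (delta y w') (mulf_neq0 a0 dw).
pose y' := y + (l * a) *: t.
rewrite mulrA -mxform_det_linl -/y' in nonc.
have [q fyw1] : exists q, f y' w' = 1 + a * q.
  exists (h + mu * f y t' + l * f t w').
  have -> : f y' w' = f y w' + (l * a) * f t w' by rewrite /f mxform_linl.
  have -> : f y w' = f y w + (a * mu) * f y t' by rewrite /f mxform_linr.
  have -> : f y w = 1 + a * h by rewrite -fyw addrC subrK.
  by rewrite 2!mulrDr !addrA !mulrA [l * a]mulrC.
pose U : 'M[R]_(2, m) := \matrix_(i, j) if i == 0 then x 0 j else y' 0 j.
pose V : 'M[R]_(s, 2) := \matrix_(i, j) if j == 0 then v i 0 else w' i 0.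
have UBV : U *m B *m V = mx22 a (f x w') (f y' v) (f y' w').
  have rowU0 : row 0 U = x by apply/matrixP=> i j; rewrite ord1 !mxE.
  have rowU1 : row 1 U = y' by apply/matrixP=> i j; rewrite ord1 !mxE.
  have colV0 : col 0 V = v by apply/matrixP=> i j; rewrite ord1 !mxE.
  have colV1 : col 1 V = w' by apply/matrixP=> i j; rewrite ord1 !mxE.
  have UBVE i j : (U *m B *m V) i j = f (row i U) (col j V).
    rewrite /f /mxform -row_mul [col j V]colE mulmxA -row_mul -colE.
    by rewrite [RHS]mxE [RHS]mxE.
  apply/matrixP=> i j; rewrite UBVE mxE.
  by move: i j; do 2!apply: ord2P; rewrite /= ?rowU0 ?rowU1 ?colV0 ?colV1.
have detE : \det (mx22 a (f x w') (f y' v) (f y' w')) = delta y' w'.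
  by rewrite det2E !mxE /delta /mxform_det -/f fa.
have [|||||C [contC detC]] := @crit a (f y' v) (f x w') (f y' w').
- by rewrite aE; apply: constOK_nat.
- exact/eqP.
- by rewrite aE; apply: double_not_unit.
- apply/seteqP; split=> // z _; exists 2, (fun i => if i == 0 then - q * z else z).
  exists (fun i => if i == 0 then a else f y' w'); split.
    by apply: ord2P; [left; left | right].
  by rewrite sum2E /= fyw1 /GRing.scale /=; ring.
- by rewrite detE.
rewrite -UBV in contC detC detE.
have [Z trZ] := (cont_full _).1 contC.
have dn0 : delta y' w' != 0.
  apply/eqP=> d0; apply: nonc; rewrite -/(delta _ _) d0.
  by exists 0; rewrite ?OK0 ?rmorph0.
have rC : rank1_mx C.
  apply/det2_rank1/eqP; move/eqP: detC; rewrite det_mulmx detE mulf_eq0.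
  by rewrite (negPf dn0).
exists (V *m C *m Z *m U).
  by rewrite mulmxA mxtrace_mulC !mulmxA.
by rewrite !mulmxA; do 2!apply: rank1_mulmxr; apply: rank1_mulmxl.
Qed.
End Splitting22.

Theorem theorem5p6 (K : fieldExtType rat) :
  (stacked_bases (IntOK K) <->
   (forall B : 'M[IntOK K]_2, cont B = [set: IntOK K] ->
      exists C : 'M[IntOK K]_2,
        cont (B *m C) = [set: IntOK K] /\ \det (B *m C) = 0)) /\
  (stacked_bases (IntOK K) <->
   (forall a b c d : IntOK K,
      constOK a -> a <> 0 -> ~ unitsOK a ->
      ideal_gen [set a; c; d] = [set: IntOK K] ->
      ~ constOK (\det (mx22 a c b d)) ->
      exists C : 'M[IntOK K]_2,
        cont (mx22 a c b d *m C) = [set: IntOK K] /\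
        \det (mx22 a c b d *m C) = 0)).
Proof.
set full := (X in (_ <-> X) /\ _); set restr := (X in _ /\ (_ <-> X)).
have SB_full : stacked_bases (IntOK K) -> full.
  by move=> SB B; apply: stacked_bases_criterion.
have full_restr : full -> restr.
  move=> critB a b c d _ _ _ acd _; apply: critB.
  have [k [e [s [sacd e1]]]] : ideal_gen [set a; c; d] 1 by rewrite acd.
  apply/seteqP; split=> // z _; apply/contP; rewrite -[z]mulr1 e1.
  apply: in_contM; apply: in_cont_sum => i _; apply: in_contM.
  have := in_cont_entry (mx22 a c b d); case: (sacd i) => [[]|] -> entry.
  - by have := entry 0 0; rewrite mxE.
  - by have := entry 0 1; rewrite mxE.
  - by have := entry 1 1; rewrite mxE.
have restr_SB : restr -> stacked_bases (IntOK K).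
  move=> crit; apply: stacked_bases_of_splitting.
  - exact: IntOK_arithmetical.
  - exact: splitting_of_criterion.
  - by move=> n; apply: IntOK_natr_neq0.
by split; split; auto.
Qed.
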